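(* Let $\mu$ be a function on Borel subsets of $\mathbf{S}^n$ such that (i) $\mu$ is nonnegative and countably additive; (ii) $\mu(\mathbf{S}^n)=\sigma(\mathbf{S}^n)$; (iii) $\mu(\mathbf{S}^n\setminus\omega)>\sigma(\omega^* )$ for every spherically convex $\omega\subset\mathbf{S}^n$, $\omega\ne\mathbf{S}^n$. Let $\tilde F\in\mathcal{F}^n$ be the convex hypersurface (unique up to rescaling) whose support and radial functions $(\tilde h,\tilde\rho)$ form the (unique up to rescaling) pair minimizing $\mathcal{Q}$ over $\mathcal{A}$. Then the problem of maximizing $\int_{\mathbf{S}^n}c(\theta^{-1}(N),N)\,d\sigma(N)$ over $\theta\in\Theta$ admits a solution $\theta_0$, and any such solution satisfies $\theta_0^{-1}=\alpha_{\tilde F}^{-1}$ $\sigma$-almost everywhere on $\mathbf{S}^n$. Furthermore, $$\mathcal{Q}[\tilde h,\tilde\rho]=\int_{\mathbf{S}^n}c(\alpha_{\tilde F}^{-1}(N),N)\,d\sigma(N)=\sup_{\theta\in\Theta}\int_{\mathbf{S}^n}c(\theta^{-1}(N),N)\,d\sigma(N).$$ In addition, for any Borel set $V\subset\mathbf{S}^n$ with $\mu(V)>0$, $\theta_0(V)=\alpha_{\tilde F}(V)$.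
   Context: $\mathbf{S}^n$ is the unit sphere in $\mathbb{R}^{n+1}$, $n\ge1$, centered at the origin $\mathcal{O}$; $\sigma$ is the standard Lebesgue measure on $\mathbf{S}^n$; $\omega^*=\{y\in\mathbf{S}^n:\langle x,y\rangle\le0\ \forall x\in\omega\}$. $\mathcal{F}^n$ is the set of boundaries of compact convex sets in $\mathbb{R}^{n+1}$ containing $\mathcal{O}$ in their interior; for $F\in\mathcal{F}^n$ its radial function $\rho(x)$ is the distance from $\mathcal{O}$ to the point where the ray in direction $x\in\mathbf{S}^n$ meets $F$, its support function is $h(N)=\sup_x\rho(x)\langle x,N\rangle$, and its generalized Gauss map $\alpha_F(x)$ is the set of outward unit normals of supporting hyperplanes to $F$ at $\rho(x)x$, with $\alpha_F(\omega)=\bigcup_{x\in\omega}\alpha_F(x)$ and $\alpha_F^{-1}(N)=\{x:N\in\alpha_F(x)\}$. $\mathcal{A}=\{(h,\rho)\in C(\mathbf{S}^n)\times C(\mathbf{S}^n): h>0,\rho>0,\ \log h(N)-\log\rho(x)\ge\log\langle x,N\rangle$ whenever $\langle x,N\rangle>0\}$ and $\mathcal{Q}[h,\rho]=\int\log h\,d\sigma-\int\log\rho\,d\mu$. The cost is $c(x,N)=\log\langle x,N\rangle$ if $\langle x,N\rangle>0$ and $c(x,N)=-\infty$ otherwise. $\Theta$ is the set of measurable, possibly multivalued, maps $\theta$ of $\mathbf{S}^n$ onto itself (with $\theta(\omega)=\bigcup_{x\in\omega}\theta(x)$, $\theta^{-1}(N)=\{x:N\in\theta(x)\}$) such that: the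 image $\theta(\omega)$ of any Borel set $\omega$ is Lebesgue measurable; $\sigma\{N\in\mathbf{S}^n:\theta^{-1}(N)\text{ contains more than one point}\}=0$; and $\int_{\mathbf{S}^n}f(\theta^{-1}(N))\,d\sigma(N)=\int_{\mathbf{S}^n}f(x)\,d\mu(x)$ for every $f\in C(\mathbf{S}^n)$.
   Formalization: The equality θ_0(V) = α_F̃(V) is proved up to a σ-null set, since a maximizer may be altered on a σ-null set of normals and literal equality then fails; condition (iii) is asked only for nonempty Borel ω, as ω = ∅ would contradict (ii). *)

(* Defs.v *)
From HB Require Import structures.
From mathcomp Require Import all_boot all_order all_algebra.
From mathcomp Require Import all_classical all_reals all_analysis.
Set Implicit Arguments. Unset Strict Implicit. Unset Printing Implicit Defensive.
Import Order.TTheory GRing.Theory Num.Theory.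
Import numFieldNormedType.Exports.
Local Open Scope classical_set_scope.
Local Open Scope ring_scope.

Section Defs.
Variables (R : realType) (n : nat).
Local Notation V := 'rV[R]_(n.+1).

Definition E := g_sigma_algebraType (@open V).

Definition dot (x y : V) : R := \sum_(i < n.+1) x 0 i * y 0 i.

Definition sphere : set V := [set x | dot x x = 1].

Definition polar (w : set V) : set V :=
  [set y | sphere y /\ forall x, w x -> dot x y <= 0].

Definition convexR (K : set V) : Prop :=
  forall u v l, K u -> K v -> 0 <= l <= 1 -> K (l *: u + (1 - l) *: v).

Definition sconvex (w : set V) : Prop :=
  convexR [set y | exists t x, 0 <= t /\ w x /\ y = t *: x].

Definition rbox (a b : V) : set V := [set x | forall i, a 0 i <= x 0 i <= b 0 i].
Definition box_vol (a b : V) : \bar R :=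
  (\prod_(i < n.+1) Num.max 0 (b 0 i - a 0 i))%:E.
Definition leb_outer (A : set V) : \bar R :=
  ereal_inf [set s | exists a b : nat -> V,
    A `<=` \bigcup_k rbox (a k) (b k) /\
    s = (\sum_(0 <= k <oo) box_vol (a k) (b k))%E].
Definition cone1 (A : set V) : set V :=
  [set y | exists t x, 0 < t <= 1 /\ A x /\ y = t *: x].
(* sigma is the standard (surface) Lebesgue measure on S^n, seen as a Borel
   measure on R^{n+1} concentrated on S^n:
   sigma(A) = (n+1) * Leb_{n+1}({t x : 0 < t <= 1, x in A /\ S^n}) *)
Definition standard_sphere_measure (s : set E -> \bar R) : Prop :=
  forall A : set E, measurable A ->
    s A = ((n.+1)%:R%:E * leb_outer (cone1 (A `&` sphere)))%E.

Definition leb_measurable (s : set E -> \bar R) (A : set V) : Prop :=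
  exists B1 B2 : set E, [/\ measurable B1, measurable B2,
    B1 `<=` A, A `<=` B2 & s (B2 `\` B1) = 0%E].

Definition in_Fn (F : set V) : Prop :=
  exists K : set V, [/\ compact K, convexR K, interior K 0 &
    F = closure K `\` interior K].
Definition radialf (F : set V) (x : V) : R := sup [set t : R | 0 < t /\ F (t *: x)].
Definition supportf (F : set V) (N : V) : R :=
  sup [set radialf F x * dot x N | x in sphere].
(* generalized Gauss map, as a relation: alpha F x N <-> N in alpha_F(x) *)
Definition gauss (F : set V) (x N : V) : Prop :=
  [/\ sphere x, sphere N & forall y, F y -> dot y N <= dot (radialf F x *: x) N].

(* ---- multivalued maps as relations: th x N <-> N in th(x) *)
Definition mimg (th : V -> V -> Prop) (A : set V) : set V :=
  [set N | exists x, A x /\ th x N].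
Definition mpre (th : V -> V -> Prop) (N : V) : set V := [set x | th x N].
(* g(th^{-1}(N)): the value of g at the unique preimage of N (when unique);
   the default value 0 is used on the sigma-null set where it is not unique *)
Definition atpre (th : V -> V -> Prop) (g : V -> \bar R) (N : V) : \bar R :=
  if pselect (exists! x, th x N) then g (xget 0 (mpre th N)) else 0%E.

Definition cost (x N : V) : \bar R :=
  if 0 < dot x N then (ln (dot x N))%:E else -oo%E.

Section Meas.
Variables (sig mu : {measure set E -> \bar R}).

Definition in_Theta (th : V -> V -> Prop) : Prop :=
  (forall x N, th x N -> sphere x /\ sphere N) /\
  (forall x, sphere x -> exists N, th x N) /\
  (forall N, sphere N -> exists x, th x N) /\
  (forall w : set E, measurable w -> w `<=` sphere ->
      leb_measurable sig (mimg th w)) /\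
  negligible sig [set N | sphere N /\
      exists x y, [/\ th x N, th y N & x <> y]] /\
  (forall f : V -> R, {within sphere, continuous f} ->
      (\int[sig]_(N in sphere) atpre th (fun x => (f x)%:E) N =
       \int[mu]_(x in sphere) (f x)%:E)%E).

Definition Jcost (th : V -> V -> Prop) : \bar R :=
  (\int[sig]_(N in sphere) atpre th (fun x => cost x N) N)%E.

Definition admissible (h rho : V -> R) : Prop :=
  [/\ {within sphere, continuous h}, {within sphere, continuous rho},
      (forall N, sphere N -> 0 < h N), (forall x, sphere x -> 0 < rho x) &
      (forall x N, sphere x -> sphere N -> 0 < dot x N ->
          ln (dot x N) <= ln (h N) - ln (rho x))].

Definition Qfun (h rho : V -> R) : \bar R :=
  (\int[sig]_(N in sphere) (ln (h N))%:E - \int[mu]_(x in sphere) (ln (rho x))%:E)%E.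

End Meas.
End Defs.

(* Main.v *)
Require Import Defs.
From HB Require Import structures.
From mathcomp Require Import all_boot all_order all_algebra.
From mathcomp Require Import all_classical all_reals all_analysis.
From mathcomp Require Import measurable_realfun.
From mathcomp Require Import ring lra zify.
Import Order.TTheory GRing.Theory Num.Theory.
Import numFieldNormedType.Exports.
Local Open Scope classical_set_scope.
Local Open Scope ring_scope.

(** With [rho] and [h] the radial and support functions of [F], the Gauss map
    sends [x] to [N] exactly when [x] attains [h N = max_x rho x * <x, N>]; its
    inverse is thus single-valued and continuous off the set of those [N] for
    which the maximum is attained twice, i.e. where the convex function [h]
    fails to be differentiable.  This set is Lebesgue null: on a grid of mesh
    [1/m], monotonicity of the subdifferential bounds, uniformly in [m], the
    number of cells of each column that contain a jump of size at least [eps].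

    Perturbing [rho] to [rho * exp (s f)] and [h] accordingly keeps the pair
    admissible, and [(ln h_s - ln h) / s] converges boundedly to [f] composed
    with the inverse Gauss map; minimality of [Q], applied to [f] and [- f],
    says precisely that the Gauss map transports [mu] to [sigma].

    Finally [ln <x, N> <= ln (h N) - ln (rho x)], with equality exactly on the
    graph of the Gauss map.  Integrating along the inverse of any [theta]
    gives [J theta <= Q], with equality if and only if the inverse of [theta]
    agrees almost everywhere with that of the Gauss map. *)

Set Implicit Arguments.
Unset Strict Implicit.
Unset Printing Implicit Defensive.

(** * Integrals and null sets *)

Section NullSets.
Context {d : measure_display} {T : measurableType d} {R : realType}.
Variable mu : {measure set T -> \bar R}.
Import HBNNSimple.
Local Open Scope ereal_scope.

(** The integral is a supremum over the simple functions below [f]; multiplying one by the indicator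
    of the complement of [Z] puts it below the restriction to [D] minus [Z] and changes it only on a
    null set. *)
Lemma ge0_integral_setD_null (D Z : set T) (f : T -> \bar R) :
  measurable Z -> mu Z = 0 -> (forall x, D x -> 0 <= f x) ->
  \int[mu]_(x in D) f x = \int[mu]_(x in D `\` Z) f x.
Proof.
move=> mZ Z0 f0.
rewrite !ge0_integralE//; last by move=> x [/f0].
have mZC : measurable (~` Z) by exact: measurableC.
apply/eqP; rewrite eq_le; apply/andP; split; apply: ge_ereal_sup => _ [h hf <-].
  apply: ereal_sup_ubound; exists (mul_nnsfun h (indic_nnsfun R mZC)).
    move=> x; rewrite -[X in X%:E <= _]/(h x * \1_(~` Z) x)%R indicE.
    have := hf x; rewrite !patchE in_setD in_setC.
    case: (x \in Z); rewrite /= ?andbF ?andbT ?mulr0 ?mulr1 //.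
  rewrite -!integralT_nnsfun.
  rewrite [RHS](@ge0_negligible_integral _ _ _ mu setT Z)//; last 2 first.
    by apply/measurable_EFinP.
    by move=> x _; rewrite lee_fin.
  rewrite setTD [LHS](@ge0_negligible_integral _ _ _ mu setT Z)//; last 2 first.
    by apply/measurable_EFinP.
    by move=> x _; rewrite lee_fin.
  rewrite setTD; apply: eq_integral => x; rewrite inE => Zx.
  by rewrite -[X in X%:E = _]/(h x * \1_(~` Z) x)%R indicE mem_set// mulr1.
apply: ereal_sup_ubound; exists h => // x /=.
apply: le_trans (hf x) _; rewrite !patchE in_setD.
by case: ifP => [/andP[->]//|_]; case: ifP => //; rewrite inE => /f0.
Qed.

(* No measurability of [f] is needed: the integral is a supremum over the
   simple functions below [f^+] and [f^-]. The maps of [Theta] are measurable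
   only for the completed sigma-algebra, so this generality is used. *)
Lemma integral_setD_null (D Z : set T) (f : T -> \bar R) :
  measurable Z -> mu Z = 0 ->
  \int[mu]_(x in D) f x = \int[mu]_(x in D `\` Z) f x.
Proof.
move=> mZ Z0; rewrite integralE [RHS]integralE.
by congr (_ - _); apply: ge0_integral_setD_null.
Qed.


(** The value [-oo] of [c] is allowed. If [c] is integrable, equal integrals force the nonnegative
    difference to vanish almost everywhere; otherwise [c <= 0] makes its integral [-oo], strictly
    below the finite integral of [g]. *)
Lemma le0_integral_le (D : set T) (c : T -> \bar R) (g : T -> R) :
  measurable D -> measurable_fun D c -> mu.-integrable D (EFin \o g) ->
  (forall x, D x -> c x <= 0) -> (forall x, D x -> c x <= (g x)%:E) ->
  \int[mu]_(x in D) c x <= \int[mu]_(x in D) (g x)%:E /\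
  (\int[mu]_(x in D) c x = \int[mu]_(x in D) (g x)%:E ->
   ae_eq mu D c (EFin \o g)).
Proof.
move=> mD mc ig c0 cg.
have gfin := integrable_fin_num mD ig.
have [ic|nic] := pselect (mu.-integrable D c).
  split; first by apply: le_integral => // x /set_mem; exact: cg.
  move=> eq_cg; have : \int[mu]_(x in D) `|(g x)%:E - c x| = 0.
    transitivity (\int[mu]_(x in D) ((g x)%:E - c x)).
      by apply: eq_integral => x /set_mem Dx; rewrite gee0_abs// subre_ge0// cg.
    by rewrite integralB// eq_cg subee.
  have mgc : measurable_fun D (fun x => (g x)%:E - c x).
    by apply: emeasurable_funB => //; exact: measurable_int ig.
  move=> /(ae_eq_integral_abs mu mD mgc); apply: filterS => x /= gc Dx.
  by move: (gc Dx); case: (c x) => [r| |]//= [] /eqP; rewrite subr_eq0 => /eqP ->.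
have -> : \int[mu]_(x in D) c x = -oo.
  have -> : \int[mu]_(x in D) c x = - \int[mu]_(x in D) `|c x|.
    rewrite -integral_ge0N//; apply: eq_integral => x /set_mem Dx.
    by rewrite lee0_abs ?oppeK ?c0.
  suff -> : \int[mu]_(x in D) `|c x| = +oo by [].
  apply/eqP; rewrite -leye_eq leNgt; apply/negP => coo.
  by apply: nic; apply/integrableP.
by split; [exact: leNye|move=> coo; move: gfin; rewrite -coo].
Qed.

End NullSets.

(** * The sphere and support functions *)

Section Sphere.
Context {R : realType} {n : nat}.
Local Notation V := 'rV[R]_(n.+1).
Local Notation S := (@sphere R n).
Implicit Types (x y z p : V) (a : R).

Lemma dotC x y : dot x y = dot y x.
Proof. by apply: eq_bigr => i _; rewrite mulrC. Qed.

Lemma dotDl x y z : dot (x + y) z = dot x z + dot y z.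
Proof. by rewrite -big_split; apply: eq_bigr => i _; rewrite mxE mulrDl. Qed.

Lemma dotDr x y z : dot z (x + y) = dot z x + dot z y.
Proof. by rewrite dotC dotDl !(dotC _ z). Qed.

Lemma dotZl a x y : dot (a *: x) y = a * dot x y.
Proof. by rewrite mulr_sumr; apply: eq_bigr => i _; rewrite mxE mulrA. Qed.

Lemma dotZr a x y : dot x (a *: y) = a * dot x y.
Proof. by rewrite dotC dotZl dotC. Qed.

Lemma dotNl x y : dot (- x) y = - dot x y.
Proof. by rewrite -scaleN1r dotZl mulN1r. Qed.

Lemma dotNr x y : dot x (- y) = - dot x y.
Proof. by rewrite dotC dotNl dotC. Qed.

Lemma dotBl x y z : dot (x - y) z = dot x z - dot y z.
Proof. by rewrite dotDl dotNl. Qed.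

Lemma dotBr x y z : dot z (x - y) = dot z x - dot z y.
Proof. by rewrite dotDr dotNr. Qed.

Lemma dot_ge0 x : 0 <= dot x x.
Proof. by apply: sumr_ge0 => i _; rewrite -expr2 sqr_ge0. Qed.

Lemma dot_eq0 x : dot x x = 0 -> x = 0.
Proof.
move=> /psumr_eq0P xx0; apply/rowP => i; rewrite mxE; apply/eqP.
by rewrite -sqrf_eq0 expr2 xx0// => j _; rewrite -expr2 sqr_ge0.
Qed.

Lemma dot_gt0 x : x <> 0 -> 0 < dot x x.
Proof. by move=> x0; rewrite lt0r dot_ge0 andbT; apply/eqP => /dot_eq0. Qed.

Lemma dot_sphere_le1 x y : S x -> S y -> dot x y <= 1.
Proof.
move=> Sx Sy; have := dot_ge0 (x - y).
by rewrite dotBl !dotBr Sx Sy (dotC y x); lra.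
Qed.

Lemma sphere_coord x i : S x -> `|x 0 i| <= 1.
Proof.
move=> Sx; rewrite -(@ler_pXn2r _ 2) ?nnegrE// expr1n real_normK ?num_real//.
rewrite -[leRHS]Sx /dot (bigD1 i)//= expr2 lerDl.
by apply: sumr_ge0 => j _; rewrite -expr2 sqr_ge0.
Qed.

Lemma sphere_normalize x : x <> 0 -> S ((Num.sqrt (dot x x))^-1 *: x).
Proof.
move=> /dot_gt0 x0; rewrite /sphere /= dotZl dotZr mulrA -invfM -expr2.
by rewrite sqr_sqrtr ?ltW// mulVf// gt_eqF.
Qed.

Lemma sphere_nonempty : S !=set0.
Proof.
eexists; apply: (@sphere_normalize (const_mx 1)) => /rowP/(_ 0)/eqP.
by rewrite !mxE oner_eq0.
Qed.

Lemma continuous_dot (T : topologicalType) (f g : T -> V) :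
  continuous f -> continuous g -> continuous (fun t => dot (f t) (g t)).
Proof.
move=> cf cg; rewrite /dot.
apply: (@continuous_big _ _ _ 0 xpredT (@add_continuous R^o)) => i _ x.
apply: cvgM.
  exact: (cvg_comp _ _ (cf x) (@coord_continuous _ _ _ 0 i (f x))).
exact: (cvg_comp _ _ (cg x) (@coord_continuous _ _ _ 0 i (g x))).
Qed.

Lemma continuous_dotl y : continuous (fun x : V => dot x y).
Proof. by apply: (@continuous_dot _ id (cst y)) ; [move=> x; exact: cvg_id|exact: cst_continuous]. Qed.

Lemma continuous_dotr y : continuous (fun x : V => dot y x).
Proof. by apply: (@continuous_dot _ (cst y) id) ; [exact: cst_continuous|move=> x; exact: cvg_id]. Qed.

Lemma closed_sphere : closed S.
Proof.
apply: (@preimage_closed _ _ (fun x : V => dot x x) [set 1]); last exact: closed_eq.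
by move=> x _; apply: (@continuous_dot _ id id) => z; exact: cvg_id.
Qed.

Lemma compact_sphere : compact S.
Proof.
apply: bounded_closed_compact closed_sphere.
exists 1; split => // M M1 x Sx.
rewrite /= [X in X <= _]/Num.Def.normr/= mx_normrE; apply: bigmax_le; first lra.
by case=> i j _; rewrite (ord1 i) (le_trans (sphere_coord j Sx))// ltW.
Qed.

Lemma compact_in_sphere (C : set V) : closed C -> C `<=` S -> compact C.
Proof. by move=> cC CS; exact: subclosed_compact cC compact_sphere CS. Qed.

Lemma closed_measurable_E (A : set V) : closed A -> measurable (A : set (E R n)).
Proof.
move=> cA; rewrite -[A]setCK; apply: measurableC.
by apply: sub_sigma_algebra; exact: closed_openC.
Qed.

Lemma measurable_sphere : measurable (S : set (E R n)).
Proof. exact: closed_measurable_E closed_sphere. Qed.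

Lemma within_continuous_measurable (D : set V) (f : V -> R) :
  {within D, continuous f} -> measurable_fun (D : set (E R n)) (f : E R n -> R).
Proof.
move=> /continuousP cf mD.
apply: (measurability _ (RGenOpens.measurableE R)) => //.
move=> _ [_ [a [b ->] <-]].
have oab : open `]a, b[%classic by exact: interval_open.
have /open_subspaceP[U oU UD] := cf _ oab.
by rewrite setIC -UD; apply: measurableI => //; apply: sub_sigma_algebra.
Qed.


(** With [C] the sphere and [r] a radial function this is [supportf], extended to a positively
    homogeneous convex function of all [y]; smaller sets [C] serve to locate contact points. *)
Definition supp (r : V -> R) (C : set V) (y : V) : R :=
  sup [set r x * dot x y | x in C].

Section Supp.
Variables (r : V -> R) (M : R) (C : set V).
Hypotheses (CS : C `<=` S) (rM : forall x, C x -> `|r x| <= M).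

(** Unit vectors have coordinates at most 1 in absolute value, so the linear forms under the
    supremum are [M]-Lipschitz for the sum norm, uniformly in [x]. *)
Lemma supp_term_le x y z : C x ->
  r x * dot x y <= r x * dot x z + M * \sum_i `|y 0 i - z 0 i|.
Proof.
move=> Cx; rewrite -lerBlDl -mulrBr -dotBr.
rewrite (le_trans (ler_norm _))// normrM ler_pM//; first exact: rM.
rewrite (le_trans (ler_norm_sum _ _ _))//; apply: ler_sum => i _.
rewrite normrM !mxE ler_piMl//.
exact/sphere_coord/CS.
Qed.

Lemma supp_has_ubound y : has_ubound [set r x * dot x y | x in C].
Proof.
exists (M * \sum_i `|y 0 i|) => _ [x Cx <-].
have := supp_term_le y 0 Cx; rewrite (_ : dot x 0 = 0); last first.
  by rewrite -(scale0r (0 : V)) dotZr mul0r.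
rewrite mulr0 add0r; under eq_bigr do rewrite mxE subr0; exact.
Qed.

Lemma le_supp x y : C x -> r x * dot x y <= supp r C y.
Proof. by move=> Cx; apply: ub_le_sup; [exact: supp_has_ubound|exists x]. Qed.

Lemma supp_le y b : C !=set0 -> (forall x, C x -> r x * dot x y <= b) ->
  supp r C y <= b.
Proof.
by move=> [x Cx] Cb; apply: ge_sup; [exists (r x * dot x y), x|move=> _ [z Cz <-]; exact: Cb].
Qed.

Lemma supp_lipschitz y z : C !=set0 ->
  supp r C y <= supp r C z + M * \sum_i `|y 0 i - z 0 i|.
Proof.
move=> C0; apply: supp_le => // x Cx.
by rewrite (le_trans (supp_term_le y z Cx))// lerD2r le_supp.
Qed.

Lemma continuous_supp : C !=set0 -> continuous (supp r C).
Proof.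
move=> C0 z; apply/(@cvgrPdist_le _ R^o _ (nbhs z)) => e e0.
pose g y := M * \sum_i `|y 0 i - z 0 i|.
have cg : continuous g.
  suff cs : continuous (fun y => \sum_i `|y 0 i - z 0 i|).
    by move=> y; have FF := @nbhs_filter V y; apply: cvgM; [exact: cvg_cst|exact: cs].
  apply: (@continuous_big _ _ _ 0 xpredT (@add_continuous R^o)) => i _ t.
  have ct : continuous (fun t : V => t 0 i - z 0 i).
    move=> u; have FF := @nbhs_filter V u.
    by apply: cvgB; [exact: coord_continuous|exact: cvg_cst].
  exact: (cvg_norm (ct t)).
have gz : g z = 0 by rewrite /g big1 ?mulr0// => i _; rewrite subrr normr0.
have := cg z; rewrite /continuous_at gz => /cvgrPdist_le/(_ _ e0).
apply: filterS => y; rewrite sub0r normrN => gy.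
have {}gy : g y <= e by rewrite (le_trans (ler_norm _)).
have gyz : g y = M * \sum_i `|z 0 i - y 0 i|.
  by rewrite /g; congr (_ * _); apply: eq_bigr => i _; rewrite distrC.
have := supp_lipschitz y z C0; have := supp_lipschitz z y C0.
rewrite -/(g y) -gyz ler_norml; lra.
Qed.

End Supp.

Lemma within_dot_continuous (r : V -> R) (C : set V) y :
  {within C, continuous r} -> {within C, continuous (fun x => r x * dot x y)}.
Proof.
move=> cr x; apply: cvgM; first exact: cr.
by apply: (continuous_subspaceT (A := C) (f := fun x => dot x y)); exact: continuous_dotl.
Qed.

Lemma sphere_bounded (r : V -> R) : {within S, continuous r} ->
  exists2 M, 0 < M & forall x, S x -> `|r x| <= M.
Proof.
move=> cr; have cn : {within S, continuous (fun x => `|r x|)}.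
  by move=> x; apply: cvg_norm; exact: cr.
have [c cS cmax] := compact_EVT_max sphere_nonempty compact_sphere cn.
exists (`|r c| + 1); first by rewrite ltr_pwDr.
by move=> x /mem_set /cmax h; rewrite (le_trans h)// lerDl.
Qed.

Lemma supp_attained (r : V -> R) (C : set V) y :
  {within S, continuous r} -> closed C -> C `<=` S -> C !=set0 ->
  exists2 x, C x & r x * dot x y = supp r C y.
Proof.
move=> cr cC CS C0.
have cf : {within C, continuous (fun x => r x * dot x y)}.
  exact/within_dot_continuous/(continuous_subspaceW CS).
have [c /set_mem Cc cmax] :=
  compact_EVT_max C0 (compact_in_sphere cC CS) cf.
exists c => //; have [M _ rM] := sphere_bounded cr.
apply/eqP; rewrite eq_le (le_supp (M := M))//=; last by move=> x /CS; exact: rM.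
by apply: supp_le => // x /mem_set; exact: cmax.
Qed.

(* The Gauss map, expressed through the radial function alone. *)
Definition contact (r : V -> R) (x N : V) : Prop :=
  [/\ S x, S N & r x * dot x N = supp r S N].

Lemma contactP (r : V -> R) x N : {within S, continuous r} -> S x -> S N ->
  supp r S N <= r x * dot x N -> contact r x N.
Proof.
move=> cr Sx SN h; split => //; apply/eqP; rewrite eq_le h andbT.
by have [M _ rM] := sphere_bounded cr; exact: (le_supp (M := M)).
Qed.

(** By compactness, a unit vector [N] has a contact point in [C] exactly when the supremum over the
    part of [C] on the sphere reaches the supremum over the whole sphere. This compares two
    continuous functions of [N]. *)
Lemma closed_contact_image (r : V -> R) (C : set V) :
  {within S, continuous r} -> closed C ->
  closed [set N | exists x, C x /\ contact r x N].
Proof.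
move=> cr cC; have [M _ rM] := sphere_bounded cr.
(* The supremum of an empty set is a default value, so the case where [C] misses the sphere is
   treated apart. *)
have [CS0|/set0P CS0] := eqVneq (C `&` S) set0.
  rewrite (_ : [set _ | _] = set0); first exact: closed0.
  apply/seteqP; split => // N [x [Cx [Sx _ _]]].
  by have : (C `&` S) x by []; rewrite CS0.
have CSS : C `&` S `<=` S by move=> x [].
have rMC : forall x, (C `&` S) x -> `|r x| <= M by move=> x [_ /rM].
rewrite (_ : [set _ | _] =
    S `&` [set N | supp r (C `&` S) N - supp r S N >= 0]); last first.
  apply/seteqP; split => [N [x [Cx [Sx SN xN]]]|N [SN /=]].
    by split => //=; rewrite -xN subr_ge0 (le_supp CSS rMC).
  have cCS : closed (C `&` S) by apply: closedI => //; exact: closed_sphere.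
  have [x [Cx Sx] <-] := supp_attained N cr cCS CSS CS0.
  by rewrite subr_ge0 => ?; exists x; split => //; exact: contactP.
apply: closedI; first exact: closed_sphere.
apply: (@preimage_closed V R (fun N => supp r (C `&` S) N - supp r S N)
  [set t | t >= 0]); last exact: closed_ge.
move=> N _; have FF := @nbhs_filter V N.
apply: cvgB; first exact: (continuous_supp CSS rMC).
exact: (continuous_supp (@subset_refl _ _) rM sphere_nonempty).
Qed.

End Sphere.

(** * Convex hypersurfaces *)

Section ConvexHypersurface.
Context {R : realType} {n : nat}.
Local Notation V := 'rV[R]_(n.+1).
Local Notation S := (@sphere R n).
Variables (F K : set V).
Hypotheses (cK : compact K) (convK : convexR K) (K0 : interior K 0).
Hypothesis FE : F = closure K `\` interior K.
Let rho := radialf F.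

Let closedK : closed K.
Proof. by apply: compact_closed => //; exact: norm_hausdorff. Qed.

Let FKE : F = K `\` interior K.
Proof. by rewrite FE -(closure_id K).1. Qed.

Lemma nbhs_ray (t : R) (x : V) (A : set V) : nbhs (t *: x) A ->
  exists2 e, 0 < e & A ((t + e) *: x).
Proof.
move=> A_; have : (fun s : R => s *: x) @ t --> t *: x.
  by apply: cvgZr_tmp; exact: cvg_id.
move=> /(_ _ A_) /nbhs_ballP[e /= e0 eA]; exists (e / 2); first by rewrite divr_gt0.
by apply: eA; rewrite /ball /= opprD addNKr normrN gtr0_norm ?divr_gt0//; lra.
Qed.

(** The line through [x] is the zero set of the squared norm of the component orthogonal to [x], so
    its trace [L] on [K] is compact and [dot _ x] has a maximum there. The maximum is positive
    because [K] is a neighbourhood of the origin. *)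
Lemma max_on_ray x : S x -> exists t, [/\ 0 < t, K (t *: x) &
  forall s, K (s *: x) -> s <= t].
Proof.
move=> Sx; pose L := K `&` [set y | dot (y - dot y x *: x) (y - dot y x *: x) = 0].
have cg : continuous (fun y : V => y - dot y x *: x).
  move=> y; have FF := @nbhs_filter V y.
  apply: cvgB; first exact: cvg_id.
  by apply: cvgZr_tmp; exact: continuous_dotl.
have cL : compact L.
  apply: (subclosed_compact _ cK); last by move=> y [].
  apply: closedI => //.
  apply: (@preimage_closed V R (fun y => dot (y - dot y x *: x) (y - dot y x *: x))
    [set 0]); last exact: closed_eq.
  by move=> y _; apply: continuous_dot.
have Lx s : K (s *: x) -> L (s *: x).
  by move=> Ks; split => //=; rewrite dotZl Sx mulr1 subrr -(scale0r 0) dotZl mul0r.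
have L0 : L !=set0.
  by exists 0; rewrite -(scale0r x); apply: Lx; rewrite scale0r; exact: interior_subset K0.
have [c /set_mem[Kc cx] cmax] := compact_EVT_max L0 cL
  (continuous_subspaceT (@continuous_dotl _ _ x)).
have {}cx : c = dot c x *: x by apply/eqP; rewrite -subr_eq0; apply/eqP/dot_eq0.
have tmax s : K (s *: x) -> s <= dot c x.
  by move=> /Lx/mem_set/cmax; rewrite dotZl Sx mulr1.
exists (dot c x); split => //; last by rewrite -cx.
have [|e e0 Ke] := @nbhs_ray 0 x K; first by rewrite scale0r.
by rewrite add0r in Ke; rewrite (lt_le_trans e0)// tmax.
Qed.

(** The homothety centred at [t *: x] with ratio [1 - s / t] sends the origin to [s *: x], and by
    convexity it sends [K], a neighbourhood of the origin, into [K]. *)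
Lemma interior_on_ray (t s : R) (x : V) : K (t *: x) -> 0 <= s < t ->
  interior K (s *: x).
Proof.
move=> Kt /andP[s0 st]; have t0 : 0 < t by lra.
pose l := s / t; have l1 : 0 <= l < 1.
  apply/andP; split; first by rewrite divr_ge0// ltW.
  by rewrite /l ltr_pdivrMr// mul1r.
have l1' : 1 - l != 0 by rewrite subr_eq0 gt_eqF//; case/andP: l1.
have /(_ (s *: x)) cphi : continuous (fun y : V => (1 - l)^-1 *: (y - s *: x)).
  move=> y; have FF := @nbhs_filter V y.
  exact: (cvgZl_tmp (cvgB cvg_id (@cvg_cst V (s *: x) V (nbhs y) FF))).
rewrite /continuous_at subrr scaler0 in cphi; have := cphi _ K0.
apply: (@filterS V _ (nbhs_filter (s *: x : V))) => y /= Ky.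
have -> : y = l *: (t *: x) + (1 - l) *: ((1 - l)^-1 *: (y - s *: x)).
  rewrite !scalerA mulfV// scale1r /l divfK ?gt_eqF//.
  by rewrite addrC subrK.
by apply: convK => //; lra.
Qed.

(** On a ray the furthest point of [K] is not interior while all earlier ones are, so the set under
    the supremum in [radialf] is a singleton. *)
Lemma radialf_spec x : S x -> [/\ 0 < rho x, F (rho x *: x),
  forall t, 0 < t -> F (t *: x) -> t = rho x & forall s, K (s *: x) -> s <= rho x].
Proof.
move=> Sx; have [t [t0 Kt tmax]] := max_on_ray Sx.
have nint : ~ interior K (t *: x).
  move=> /nbhs_ray[e e0 Ke]; have := tmax _ (Ke); lra.
have Ft : F (t *: x) by rewrite FKE; exact: conj Kt nint.
have Funique s : 0 < s -> F (s *: x) -> s = t.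
  move=> s0; rewrite FKE => -[Ks nKs]; apply/eqP; rewrite eq_le (tmax _ Ks) leNgt.
  apply/negP => st; apply: nKs; apply: (interior_on_ray Kt).
  by rewrite (ltW s0).
have FT : [set s : R | 0 < s /\ F (s *: x)] = [set t].
  apply/seteqP; split=> s /=; first by case; exact: Funique.
  by move=> ->; exact: conj t0 Ft.
have rt : rho x = t by rewrite /rho /radialf FT sup1.
by rewrite rt; exact: And4 t0 Ft Funique tmax.
Qed.

Lemma hypersurface_radial y : F y -> exists2 x, S x & y = rho x *: x.
Proof.
move=> Fy; have y0 : y <> 0.
  by move=> y0; move: Fy; rewrite FKE y0 => -[].
have := dot_gt0 y0; rewrite -sqrtr_gt0 => r0.
have Sx := sphere_normalize y0.
exists ((Num.sqrt (dot y y))^-1 *: y) => //.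
have [_ _ + _] := radialf_spec Sx => /(_ _ r0).
rewrite scalerA mulfV ?gt_eqF// scale1r => /(_ Fy) <-.
by rewrite scalerA mulfV ?gt_eqF// scale1r.
Qed.

Hypothesis rhoc : {within S, continuous rho}.

(** Every point of [F] has the form [rho z *: z], so a supporting hyperplane condition over [F] is a
    maximum condition over the sphere. *)
Lemma gauss_contact : gauss F = contact rho.
Proof.
apply/funext => x; apply/funext => N; apply/propext; split=> [[Sx SN xN]|[Sx SN xN]].
  apply: contactP => //; apply: supp_le; first exact: sphere_nonempty.
  by move=> z Sz; rewrite -!dotZl; apply: xN; have [] := radialf_spec Sz.
split => // y /hypersurface_radial[z Sz ->]; rewrite !dotZl xN.
by have [M _ rM] := sphere_bounded rhoc; exact: (le_supp (@subset_refl _ S) rM).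
Qed.

(** The normal points from the nearest point [c] of [K] to [q]: a point [y] of [K] beyond the
    hyperplane through [c] would allow moving from [c] towards [y] and getting closer to [q]. *)
Lemma separation q : ~ K q -> exists2 N, S N & forall y, K y -> dot y N <= dot q N.
Proof.
move=> nKq.
have cd : continuous (fun y : V => dot (y - q) (y - q)).
  apply: continuous_dot => y; have FF := @nbhs_filter V y;
    by apply: cvgB; [exact: cvg_id|exact: cvg_cst].
have [] := compact_EVT_min _ cK (continuous_subspaceT cd).
  by exists 0; exact: interior_subset K0.
move=> c /set_mem Kc cmin; pose w := q - c.
have w0 : w <> 0 by move=> /eqP; rewrite subr_eq0 => /eqP qc; apply: nKq; rewrite qc.
have key y : K y -> dot (y - c) w <= 0.
  move=> Ky; rewrite leNgt; apply/negP => h.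
  have d0 := dot_ge0 (y - c).
  (* Moving by [l] changes the squared distance by [l * (l * |y - c|^2 - 2 * <y - c, w>)], negative
     for this [l]; the added 1 keeps the denominator positive. *)
  pose l := Num.min 1 (dot (y - c) w / (dot (y - c) (y - c) + 1)).
  have d1 : 0 < dot (y - c) (y - c) + 1 by lra.
  have l0 : 0 < l by rewrite lt_min ltr01 divr_gt0.
  have l1 : l <= 1 by rewrite ge_min lexx.
  have ld : l * (dot (y - c) (y - c) + 1) <= dot (y - c) w.
    by rewrite -ler_pdivlMr// ge_min lexx orbT.
  have Kl : K (l *: y + (1 - l) *: c) by apply: convK => //; lra.
  have := cmin _ (mem_set Kl).
  have -> : l *: y + (1 - l) *: c - q = l *: (y - c) - w.
    by apply/rowP => i; rewrite !mxE; ring.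
  have -> : c - q = - w by rewrite opprB.
  have exp_dot (u v : V) : dot (l *: u - v) (l *: u - v) - dot (- v) (- v) =
      l * (l * dot u u - 2 * dot u v).
    by rewrite dotNl dotNr opprK dotBl !dotBr !dotZl !dotZr (dotC v); ring.
  have neg : l * (l * dot (y - c) (y - c) - 2 * dot (y - c) w) < 0.
    by rewrite pmulr_rlt0//; lra.
  by have := exp_dot (y - c) w; lra.
exists ((Num.sqrt (dot w w))^-1 *: w); first exact: sphere_normalize.
move=> y /key; rewrite !dotZr => yw.
have s0 : 0 < (Num.sqrt (dot w w))^-1 by rewrite invr_gt0 sqrtr_gt0 dot_gt0.
rewrite ler_pM2l//; have ww : 0 <= dot (q - c) w by exact: (dot_ge0 w).
by rewrite dotBl in ww; rewrite dotBl in yw; lra.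
Qed.

(** The gap [g] attains its minimum on the sphere. Separating [(rho x + e) *: x] from [K] yields a
    normal with gap at most [e], so the minimum is at most 0. *)
Lemma exists_contact x : S x -> exists N, contact rho x N.
Proof.
move=> Sx; have [M _ rM] := sphere_bounded rhoc.
have [r0 _ _ rmax] := radialf_spec Sx.
pose g N := supp rho S N - rho x * dot x N.
have cg : continuous g.
  move=> N; have FF := @nbhs_filter V N.
  apply: cvgB; first exact: (continuous_supp (@subset_refl _ S) rM sphere_nonempty).
  by apply: cvgMl_tmp; exact: continuous_dotr.
have [N /set_mem SN Nmin] := compact_EVT_min sphere_nonempty compact_sphere
  (continuous_subspaceT cg).
exists N; apply: contactP => //; rewrite -subr_le0 -/(g N).
apply/ler_addgt0Pr => e e0; rewrite add0r.
have [|N' SN' N'max] := @separation ((rho x + e) *: x).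
  by move=> /rmax; lra.
rewrite (le_trans (Nmin _ (mem_set SN')))// /g lerBlDr.
apply: supp_le; first exact: sphere_nonempty.
move=> z Sz; rewrite -dotZl (le_trans (N'max _ _))//.
  by have [_ + _ _] := radialf_spec Sz; rewrite FKE => -[].
by rewrite dotZl mulrDl addrC lerD2r -[leRHS]mulr1 ler_pM2l// dot_sphere_le1.
Qed.

End ConvexHypersurface.

(** * Almost everywhere differentiability of support functions *)

Section Covering.
Context {R : realType} {n : nat}.
Local Notation V := 'rV[R]_(n.+1).
Local Notation S := (@sphere R n).
Implicit Types (x y z p : V) (a : R).

Lemma box_vol_ge0 (a b : V) : (0 <= box_vol a b)%E.
Proof. by rewrite lee_fin prodr_ge0// => i _; rewrite le_max lexx. Qed.

Lemma leb_outer_finite_cover (A : set V) (s : seq (V * V)) (v : R) :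
  (forall ab, ab \in s -> (box_vol ab.1 ab.2 <= v%:E)%E) ->
  (forall y, A y -> exists2 ab, ab \in s & rbox ab.1 ab.2 y) ->
  (leb_outer A <= ((size s)%:R * v)%:E)%E.
Proof.
move=> vols cover.
pose a k := (nth 0 s k).1; pose b k := (nth 0 s k).2.
apply: (@le_trans _ _ (\sum_(0 <= k <oo) box_vol (a k) (b k))%E).
  apply: ereal_inf_lbound; exists a, b; split => // y /cover[ab sab yab].
  by exists (index ab s) => //; rewrite /a /b nth_index.
rewrite (@nneseries_split _ _ 0 (size s)); last by move=> k _; exact: box_vol_ge0.
rewrite add0n eseries0 ?adde0; last first.
  (* Past the end of [s] the default box is reduced to the origin, and its first side already has
     length 0. *)
  move=> k sk _; rewrite /a /b nth_default// /box_vol big_ord_recl /=.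
  by rewrite mxE subrr maxxx mul0r.
rewrite big_mkord; apply: (@le_trans _ _ (\sum_(k < size s) v%:E)%E).
  by apply: lee_sum => k _; apply: vols; rewrite mem_nth.
by rewrite sumEFin sumr_const card_ord mulr_natl.
Qed.

(* The points where [y |-> max_{p in P} <p, y>] has two subgradients whose
   [i]-th coordinates differ by at least [eps]. *)
Definition jump (P : set V) (i : 'I_n.+1) (eps : R) : set V :=
  [set y | exists p q, [/\ P p, P q, forall r, P r -> dot r y <= dot p y,
    forall r, P r -> dot r y <= dot q y & eps <= q 0 i - p 0 i]].

Section Jump.
Variables (P : set V) (L eps : R) (i : 'I_n.+1).
Hypotheses (eps0 : 0 < eps) (PL : forall p, P p -> forall j, `|p 0 j| <= L).

(* Monotonicity of the subdifferential along a thin column: moving up by at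
   least [M] times its width can lower the [i]-th slope by at most [eps / 2],
   which a jump of size [eps] overcompensates. *)
Lemma jump_separated (M : nat) (d : R) y y' p q p' q' : 0 < d ->
  4 * L * n.+1%:R <= M%:R * eps -> (0 < M)%N ->
  P p -> P q -> P p' -> P q' ->
  (forall r, P r -> dot r y <= dot q y) ->
  (forall r, P r -> dot r y' <= dot p' y') ->
  eps <= q' 0 i - p' 0 i ->
  M%:R * d <= y' 0 i - y 0 i ->
  (forall j, j != i -> `|y' 0 j - y 0 j| <= d) ->
  q 0 i + eps / 2 <= q' 0 i.
Proof.
move=> d0 ML M0 Pp Pq Pp' Pq' qy py' jp' yi yj.
suff : - (eps / 2) <= p' 0 i - q 0 i by lra.
have : 0 <= dot (p' - q) (y' - y).
  by rewrite dotBr !dotBl; have := qy _ Pp'; have := py' _ Pq; lra.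
have L0 : 0 <= L by rewrite (le_trans _ (PL Pp i)).
rewrite /dot (bigD1 i)//= !mxE => dge0.
have : \sum_(j < n.+1 | j != i) (p' - q) 0 j * (y' - y) 0 j <= n.+1%:R * (2 * L * d).
  apply: (@le_trans _ _ (\sum_(j < n.+1) (2 * L * d))); last first.
    by rewrite sumr_const card_ord -[leLHS]mulr_natl.
  rewrite [leRHS](bigD1 i)//= -[leLHS]add0r; apply: lerD.
    by rewrite !mulr_ge0// ltW.
  apply: ler_sum => j ji; rewrite !mxE (le_trans (ler_norm _))// normrM.
  apply: ler_pM => //; last exact: yj.
  by rewrite (le_trans (ler_normB _ _))// mulr2n mulrDl mul1r lerD// PL.
move=> sumle; rewrite leNgt; apply/negP => pq.
have M0' : 0 < M%:R :> R by rewrite ltr0n.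
have yi0 : 0 < y' 0 i - y 0 i by rewrite (lt_le_trans _ yi)// mulr_gt0.
have h1 : (p' 0 i - q 0 i) * (y' 0 i - y 0 i) < - (eps / 2) * (y' 0 i - y 0 i).
  by rewrite ltr_pM2r.
have h2 : - (eps / 2) * (y' 0 i - y 0 i) <= - (eps / 2) * (M%:R * d).
  by rewrite ler_nM2l// oppr_lt0 divr_gt0.
have h3 : 4 * L * n.+1%:R * d <= M%:R * eps * d by rewrite ler_pM2r.
by lra.
Qed.

Local Notation cell m := {ffun 'I_n.+1 -> 'I_(2 * m).+1}.

(** Half-open cubes of side [1 / m] covering the cube [[-1, 1]]; there are [2 * m + 1] per axis
    because the coordinate 1 itself has index [2 * m]. *)
Let in_cell (m : nat) (c : cell m) y :=
  forall j, (c j)%:R <= (y 0 j + 1) * m%:R < (c j).+1%:R.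

Lemma in_cell_dist (m : nat) (c c' : cell m) j y y' : (0 < m)%N ->
  in_cell c y -> in_cell c' y' -> c j = c' j -> `|y' 0 j - y 0 j| <= m%:R^-1.
Proof.
move=> m0 /(_ j)/andP[h1 h2] /(_ j)/andP[h3 h4] cc; rewrite -cc in h3 h4.
have m0' : 0 < m%:R :> R by rewrite ltr0n.
rewrite -[leRHS]mul1r ler_pdivlMr// -[X in _ * X](gtr0_norm m0') -normrM ler_norml.
by rewrite -natr1 in h2 h4; lra.
Qed.

Lemma exists_cell (m : nat) y : (forall j, `|y 0 j| <= 1) ->
  exists c : cell m, in_cell c y.
Proof.
move=> y1; have y0 j : 0 <= (y 0 j + 1) * m%:R.
  by rewrite mulr_ge0//; have := y1 j; rewrite ler_norml; lra.
have tr j : (Num.truncn ((y 0 j + 1) * m%:R)%R < (2 * m).+1)%N.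
  rewrite ltnS truncn_le_nat -natr1 natrM ltr_pwDr// ler_wpM2r//.
  by have := y1 j; rewrite ler_norml; lra.
by exists [ffun j => Ordinal (tr j)] => j; rewrite ffunE /=; exact: truncn_itv.
Qed.

(* A cell is determined by its coordinates other than [i], its [i]-th
   coordinate modulo [M + 1] and the slope of one of its points rounded to
   multiples of [eps / 2]. *)
Lemma card_jump_cells (m M K : nat) (A : {set cell m}) : (0 < m)%N ->
  4 * L * n.+1%:R <= M%:R * eps -> (0 < M)%N -> 4 * L <= K%:R * eps ->
  (forall c, c \in A -> exists2 y, in_cell c y & jump P i eps y) ->
  (#|A| <= (2 * m).+1 ^ n * M.+1 * K.+1)%N.
Proof.
move=> m0 ML M0 KL AJ.
have /choice[w wP] : forall c, exists w : V * V * V, c \in A ->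
    [/\ in_cell c w.1.1, P w.1.2 /\ P w.2, eps <= w.2 0 i - w.1.2 0 i,
     forall r, P r -> dot r w.1.1 <= dot w.1.2 w.1.1 &
     forall r, P r -> dot r w.1.1 <= dot w.2 w.1.1].
  move=> c; case: (boolP (c \in A)) => [/AJ[y cy [p [q [Pp Pq py qy jpq]]]]|_].
    by exists (y, p, q).
  by exists 0.
have m0' : 0 < m%:R :> R by rewrite ltr0n.
(* The larger slope, measured from [- L] in units of [eps / 2]. It lies between 0 and
   [4 * L / eps <= K], which leaves [K.+1] possible integer parts. *)
pose t c := ((w c).2 0 i + L) * (2 / eps).
have tK c : c \in A -> 0 <= t c < K.+1%:R.
  move=> /wP[_ [_ Pq] _ _ _]; have := PL Pq i; rewrite ler_norml => /andP[h1 h2].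
  rewrite mulr_ge0//=; [|lra|by rewrite divr_ge0// ltW].
  rewrite /t mulrA ltr_pdivrMr// (@le_lt_trans _ _ (4 * L))//; first lra.
  by rewrite (le_lt_trans KL)// ltr_pM2r// ltr_nat.
pose g (c : cell m) := ([ffun k : 'I_n => c (lift i k)],
  (inord (c i %% M.+1) : 'I_M.+1), (inord (Num.truncn (t c)) : 'I_K.+1)).
rewrite (_ : (_ ^ n * M.+1 * K.+1)%N =
    #|{: {ffun 'I_n -> 'I_(2 * m).+1} * 'I_M.+1 * 'I_K.+1}|); last first.
  by rewrite !card_prod card_ffun !card_ord.
apply: (@leq_card_in _ _ g) => c c' cA c'A [gc gi gt].
wlog cc' : c c' cA c'A gc gi gt / (c i <= c' i)%N.
  by move=> H; case/orP: (leq_total (c i) (c' i)) => ?; [|apply/esym]; exact: H.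
have eqc j : j != i -> c j = c' j.
  move=> ji; have [k ->] : exists k, j = lift i k.
    by rewrite eq_sym in ji; have [k ->] := unlift_some ji; exists k.
  by move/ffunP/(_ k): gc; rewrite !ffunE.
have {}gi : (c i = c' i %[mod M.+1])%N.
  by move/(congr1 val): gi; rewrite /= !inordK ?ltn_pmod.
have {}gt : Num.truncn (t c) = Num.truncn (t c').
  have /andP[? ?] := tK _ cA; have /andP[? ?] := tK _ c'A.
  by move/(congr1 val): gt; rewrite /= !inordK ?truncn_lt_nat.
suff eqci : c i = c' i.
  by apply/ffunP => j; have [->|/eqc] := eqVneq j i.
apply/val_inj/eqP; rewrite eqn_leq cc' /= leqNgt; apply/negP => lcc'.
(* Distinct indices congruent modulo [M.+1] differ by at least [M.+1]; one unit is lost to the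
   positions inside the cells, which leaves the gap [M / m] required by [jump_separated]. *)
have Mcc' : (c i + M.+1 <= c' i)%N.
  have /dvdn_leq : (M.+1 %| c' i - c i)%N by rewrite -eqn_mod_dvd// eq_sym; apply/eqP.
  by rewrite subn_gt0 => /(_ lcc'); lia.
have [cw [Pp Pq] jpq py qy] := wP _ cA.
have [cw' [Pp' Pq'] jpq' py' qy'] := wP _ c'A.
have : (w c).2 0 i + eps / 2 <= (w c').2 0 i.
  apply: (@jump_separated M m%:R^-1 (w c).1.1 (w c').1.1 (w c).1.2 _ (w c').1.2) => //.
    by rewrite invr_gt0.
    have /andP[_ h1] := cw i; have /andP[h2 _] := cw' i.
    rewrite ler_pdivrMr//.
    have : (c i)%:R + M%:R + 1 <= (c' i)%:R :> R.
      by rewrite -natrD natr1 ler_nat -addnS.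
    by rewrite -natr1 in h1; lra.
  by move=> j ji; apply: (in_cell_dist m0 cw cw'); exact: eqc.
move=> qq'; have : t c + 1 <= t c'.
  have -> : 1 = eps / 2 * (2 / eps) by field; rewrite gt_eqF.
  by rewrite /t -mulrDl ler_pM2r ?divr_gt0//; lra.
have /andP[t0 _] := tK _ cA; have /andP[t0' _] := tK _ c'A.
have /andP[h1 h2] := truncn_itv t0; have /andP[h3 h4] := truncn_itv t0'.
by rewrite -gt -natr1 in h4; lra.
Qed.

End Jump.
(** Of the cells of volume [m^-(n+1)], only a constant times [m^n] meet [J], so the outer measure is
    at most [D / m] for every [m]. *)
Lemma leb_outer_jump (P : set V) (L eps : R) (i : 'I_n.+1) (J : set V) :
  0 < eps -> (forall p, P p -> forall j, `|p 0 j| <= L) ->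
  J `<=` jump P i eps -> (forall y, J y -> forall j, `|y 0 j| <= 1) ->
  (leb_outer J <= 0)%E.
Proof.
move=> eps0 PL Jjump J1.
pose M := (Num.truncn (4 * L * n.+1%:R / eps)).+1.
pose K := (Num.truncn (4 * L / eps)).+1.
have ML : 4 * L * n.+1%:R <= M%:R * eps.
  by rewrite -ler_pdivrMr// ltW// truncnS_gt.
have KL : 4 * L <= K%:R * eps by rewrite -ler_pdivrMr// ltW// truncnS_gt.
(* The factor [3 ^ n] comes from [2 * m + 1 <= 3 * m]. *)
pose D : R := (3 ^ n * M.+1 * K.+1)%:R.
have cover m : (0 < m)%N -> (leb_outer J <= (D / m%:R)%:E)%E.
  move=> m0; have m0' : 0 < m%:R :> R by rewrite ltr0n.
  pose ic (c : {ffun 'I_n.+1 -> 'I_(2 * m).+1}) (y : V) :=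
    forall j, (c j)%:R <= (y 0 j + 1) * m%:R < (c j).+1%:R.
  pose A := [set c | `[< exists2 y, ic c y & J y >]]%SET.
  pose a (c : {ffun 'I_n.+1 -> 'I_(2 * m).+1}) : V :=
    \row_j ((c j)%:R / m%:R - 1).
  pose b (c : {ffun 'I_n.+1 -> 'I_(2 * m).+1}) : V :=
    \row_j ((c j).+1%:R / m%:R - 1).
  have cardA : (#|A| <= (2 * m).+1 ^ n * M.+1 * K.+1)%N.
    apply: (card_jump_cells eps0 PL) => // c; rewrite inE => /asboolP[y cy Jy].
    by exists y => //; exact: Jjump.
  apply: (@le_trans _ _ ((#|A|)%:R * m%:R^-1 ^+ n.+1)%:E).
    rewrite cardE -(size_map (fun c => (a c, b c))).
    apply: leb_outer_finite_cover => [_ /mapP[c _ ->]|y Jy].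
      rewrite lee_fin /= (eq_bigr (fun=> m%:R^-1)); last first.
        move=> j _; rewrite !mxE -natr1.
        rewrite (_ : _ - _ = m%:R^-1); first by rewrite max_r// invr_ge0.
        by rewrite mulrDl mul1r; lra.
      by rewrite prodr_const card_ord.
    have [c cy] := exists_cell m (J1 _ Jy).
    exists (a c, b c).
      apply/mapP; exists c => //; rewrite mem_enum inE; apply/asboolP.
      by exists y.
    move=> j; rewrite /= !mxE; have /andP[h1 h2] := cy j.
    rewrite lerBlDr ler_pdivrMr// h1 /= lerBrDr ler_pdivlMr//.
    exact: ltW.
  rewrite lee_fin exprS mulrCA mulrC ler_pM2r ?invr_gt0//.
  have mV0 : 0 < m%:R^-1 ^+ n :> R by rewrite exprn_gt0// invr_gt0.
  rewrite exprVn ler_pdivrMr ?exprn_gt0// -natrX -natrM ler_nat.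
  apply: (leq_trans cardA).
  have -> : (3 ^ n * M.+1 * K.+1 * m ^ n = (3 * m) ^ n * M.+1 * K.+1)%N.
    by rewrite expnMn; lia.
  rewrite !leq_mul2r; apply/orP; right; apply/orP; right.
  by elim: (n) => // k IH; rewrite !expnS leq_mul//; lia.
apply/lee_addgt0Pr => e e0; rewrite add0e.
apply: (le_trans (cover (Num.truncn (D / e)).+1 _)) => //.
rewrite lee_fin ler_pdivrMr// mulrC -ler_pdivrMr// ltW//.
exact: truncnS_gt.
Qed.

End Covering.

(** * Nullity of multiple contact and measurability of the inverse Gauss map *)

Section Contact.
Context {R : realType} {n : nat}.
Local Notation V := 'rV[R]_(n.+1).
Local Notation S := (@sphere R n).
Variable sig : {measure set (E R n) -> \bar R}.
Hypothesis sigE : standard_sphere_measure sig.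

Let cone1_coord (A : set V) y j : cone1 (A `&` S) y -> `|y 0 j| <= 1.
Proof.
move=> [t [x [/andP[t0 t1] [[_ Sx] ->]]]]; rewrite mxE normrM gtr0_norm//.
by apply: mulr_ile1 => //; [exact: ltW|exact: sphere_coord].
Qed.

Lemma sphere_measure_fin : (sig S < +oo)%E.
Proof.
rewrite sigE; last exact: measurable_sphere.
have : (leb_outer (cone1 (S `&` S)) <=
    (1%:R * \prod_(i < n.+1) 2)%:E :> \bar R)%E.
  apply: (@leb_outer_finite_cover _ _ _ [:: (const_mx (-1), const_mx 1)]).
    move=> ab; rewrite inE => /eqP ->; rewrite lee_fin ler_prod// => i _.
    by rewrite !mxE le_max lexx/= ge_max; lra.
  move=> y Sy; exists (const_mx (-1), const_mx 1); first by rewrite inE.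
  by move=> i; rewrite /= !mxE -ler_norml; exact: cone1_coord Sy.
move=> h; apply: (le_lt_trans (lee_wpmul2l _ h)) => //.
by rewrite -EFinM ltry.
Qed.

Lemma closed_within (f : V -> R) (D : set R) : {within S, continuous f} ->
  closed D -> closed (S `&` f @^-1` D).
Proof.
move=> /continuous_closedP cf /cf /closed_subspaceP[U cU US].
by rewrite setIC -US; apply: closedI => //; exact: closed_sphere.
Qed.

Variable rho : V -> R.
Hypothesis rhoc : {within S, continuous rho}.
Hypothesis rho0 : forall x, S x -> 0 < rho x.

Definition multi_contact : set V :=
  [set N | S N /\ exists x y, [/\ contact rho x N, contact rho y N & x <> y]].

(* A normal with two contact points has two whose [i]-th coordinates are
   separated by rationals [a < b], for some [i]. *)
Definition split_contact (i : 'I_n.+1) (a b : R) : set V :=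
  [set N | exists x, (S `&` (fun x => rho x * x 0 i) @^-1` [set t | t <= a]) x /\
     contact rho x N] `&`
  [set N | exists x, (S `&` (fun x => rho x * x 0 i) @^-1` [set t | b <= t]) x /\
     contact rho x N].

Lemma closed_split_contact i a b : closed (split_contact i a b).
Proof.
have rc : {within S, continuous (fun x : V => rho x * x 0 i)}.
  move=> x; apply: cvgM; first exact: rhoc.
  by apply: (@continuous_subspaceT _ _ S (fun x : V => x 0 i)); exact: coord_continuous.
apply: closedI; apply: closed_contact_image => //; apply: closed_within => //.
Qed.

(** If [x] is a contact point at [N], then [rho x *: x] is a subgradient of the support function at
    every [t *: N] with [t > 0]. The cone over the set therefore consists of jumps of size at least
    [b - a]. *)
Lemma split_contact_null i a b : a < b -> sig (split_contact i a b) = 0%E.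
Proof.
move=> ab; apply/eqP; rewrite eq_le measure_ge0 andbT sigE; last first.
  by apply: closed_measurable_E; exact: closed_split_contact.
apply: mule_ge0_le0 => //.
have [L _ rL] := sphere_bounded rhoc.
apply: (@leb_outer_jump _ _ [set rho x *: x | x in S] L (b - a) i).
- by rewrite subr_gt0.
- move=> _ [x Sx <-] j; rewrite mxE normrM -[leRHS]mulr1 ler_pM//.
    exact: rL.
  exact: sphere_coord.
- move=> _ [t [N [/andP[t0 t1] [[sN _] ->]]]].
  move: sN => [[x [[Sx /= xa] [_ _ cx]]] [y [[Sy /= yb] [_ _ cy]]]].
  exists (rho x *: x), (rho y *: y); split.
  + by exists x.
  + by exists y.
  + move=> _ [z Sz <-]; rewrite !dotZr !dotZl ler_pM2l// cx.
    exact: (le_supp (@subset_refl _ _) rL).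
  + move=> _ [z Sz <-]; rewrite !dotZr !dotZl ler_pM2l// cy.
    exact: (le_supp (@subset_refl _ _) rL).
  + by rewrite !mxE; lra.
- by move=> y Sy j; exact: cone1_coord Sy.
Qed.

Let split_seq (k : nat) : set (E R n) :=
  if @unpickle ('I_n.+1 * rat * rat)%type k is Some (i, a, b) then
    if a < b then split_contact i (ratr a) (ratr b) else set0
  else set0 : set (E R n).

Let multi_contactE : multi_contact = \bigcup_k split_seq k.
Proof.
apply/seteqP; split => [N [SN [x [y [cx cy xy]]]]|N [k _]]; last first.
  rewrite /split_seq; case: unpickle => // -[[i a] b].
  case: ifP => // ab [[x [[Sx /= xa] cx]] [y [[Sy /= yb] cy]]].
  split; first by case: cx.
  exists x, y; split => // xy; move: yb; rewrite -xy => /le_trans/(_ xa).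
  by rewrite ler_rat leNgt ab.
wlog [i xyi] : x y cx cy xy / exists i, rho x * x 0 i < rho y * y 0 i.
  (* If all coordinates of [rho x *: x] and [rho y *: y] agreed, comparing norms would give
     [rho x = rho y], hence [x = y]. *)
  move=> H; have [i] : exists i, rho x * x 0 i != rho y * y 0 i.
    apply: contrapT => /forallNP xyi; apply: xy.
    have e : rho x *: x = rho y *: y.
      by apply/rowP => i; rewrite !mxE; apply/eqP/negP/negP/negPn; have /negP := xyi i.
    have [Sx _ _] := cx; have [Sy _ _] := cy.
    have : dot (rho x *: x) (rho x *: x) = dot (rho y *: y) (rho y *: y) by rewrite e.
    rewrite !dotZl !dotZr Sx Sy !mulr1 -!expr2 => /eqP.
    rewrite eqrXn2 ?ltW ?rho0// => /eqP rxy.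
    move: e; rewrite rxy => /(congr1 (fun z => (rho y)^-1 *: z)).
    by rewrite !scalerA mulVf ?scale1r// gt_eqF// rho0.
  rewrite neq_lt => /orP[h|h]; first by apply: (H x y) => //; exists i.
  by apply: (H y x) => //; [exact/nesym|exists i].
have [a] := rat_in_itvoo xyi; rewrite in_itv /= => /andP[xa ay].
have [b] := rat_in_itvoo ay; rewrite in_itv /= => /andP[ab yb].
have [[Sx _ _] [Sy _ _]] := (cx, cy).
exists (pickle (i, a, b)) => //; rewrite /split_seq pickleK.
rewrite -(ltr_rat R) ab; split.
  by exists x; split => //; split => //=; exact: ltW.
by exists y; split => //; split => //=; exact: ltW.
Qed.

Lemma multi_contact_null : measurable (multi_contact : set (E R n)) /\
  sig multi_contact = 0%E.
Proof.
have mB : measurable (multi_contact : set (E R n)).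
  rewrite multi_contactE; apply: bigcupT_measurable => k.
  rewrite /split_seq; case: unpickle => // -[[i a] b]; case: ifP => // _.
  by apply: closed_measurable_E; exact: closed_split_contact.
split => //; apply/negligibleP => //; rewrite multi_contactE.
apply: negligible_bigcup => k; rewrite /split_seq.
case: unpickle => [[[i a] b]|]; last exact: negligible_set0.
case: ifPn => [ab|_]; last exact: negligible_set0.
apply/negligibleP; first by apply: closed_measurable_E; exact: closed_split_contact.
by apply: split_contact_null; rewrite ltr_rat.
Qed.

(** For continuous [rho] the default 0 occurs only off the sphere; on [multi_contact] some contact
    point is chosen. *)
Definition contact_inv (N : V) : V := xget 0 (mpre (contact rho) N).

Lemma contact_invP N : S N -> contact rho (contact_inv N) N.
Proof.
move=> SN; have [x Sx xN] := supp_attained N rhoc closed_sphere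
  (@subset_refl _ _) sphere_nonempty.
by apply: (@xgetPex _ 0 (mpre (contact rho) N)); exists x.
Qed.

Lemma contact_inv_unique N x : (S `\` multi_contact) N -> contact rho x N ->
  x = contact_inv N.
Proof.
move=> [SN nB] cx; apply: contrapT => xX; apply: nB; split => //.
by exists x, (contact_inv N); split => //; exact: contact_invP.
Qed.

(** Where the contact point is unique, the preimage of an open set is the complement of the contact
    image of a closed set, and that image is closed. *)
Lemma measurable_contact_inv :
  measurable_fun (S `\` multi_contact : set (E R n)) (contact_inv : E R n -> E R n).
Proof.
have [mB _] := multi_contact_null.
have mD : measurable (S `\` multi_contact : set (E R n)).
  by apply: measurableD => //; exact: measurable_sphere.
apply: (@measurability _ _ (E R n) (E R n) _ _ (@open V)) => //.
move=> _ [U oU <-]; rewrite -[U]setCK preimage_setC.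
rewrite (_ : _ `&` _ = (S `\` multi_contact) `\`
    [set N | exists x, (~` U) x /\ contact rho x N]); last first.
  apply/seteqP; split=> N [SN nU]; split => //.
    move=> [x [Ux cx]]; apply: nU.
    by rewrite /preimage /= -(contact_inv_unique SN cx).
  by move=> UN; apply: nU; exists (contact_inv N); split => //; apply: contact_invP; case: SN.
apply: measurableD => //; apply: closed_measurable_E.
by apply: closed_contact_image => //; exact: open_closedC.
Qed.

(** Up to the null set [multi_contact], the image of [w] is the Borel preimage of [w] under
    [contact_inv]. *)
Lemma leb_measurable_contact_image (w : set (E R n)) : measurable w ->
  leb_measurable sig (mimg (contact rho) w).
Proof.
move=> mw; have [mB B0] := multi_contact_null.
have mD : measurable (S `\` multi_contact : set (E R n)).
  by apply: measurableD => //; exact: measurable_sphere.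
have mX := measurable_contact_inv mD mw.
exists ((S `\` multi_contact) `&` contact_inv @^-1` w),
  ((S `\` multi_contact) `&` contact_inv @^-1` w `|` multi_contact); split => //.
- exact: measurableU.
- move=> N [[SN _] XN]; exists (contact_inv N); split => //; exact: contact_invP.
- move=> N [x [wx cx]]; have [|nB] := pselect (multi_contact N); [by right|left].
  have SN : S N by case: cx.
  by split => //; rewrite /preimage /= -(contact_inv_unique _ cx).
- apply: (@subset_measure0 _ _ _ sig _ multi_contact) => //.
    by apply: measurableD => //; exact: measurableU.
  by move=> N [[]].
Qed.
End Contact.

(** * First variation of Q *)

Section Variation.
Context {R : realType} {n : nat}.
Local Notation V := 'rV[R]_(n.+1).
Local Notation S := (@sphere R n).

Lemma within_ln_continuous (f : V -> R) : {within S, continuous f} ->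
  (forall x, S x -> 0 < f x) -> {within S, continuous (fun x => ln (f x))}.
Proof.
move=> cf f0; rewrite continuous_subspace_in => x /set_mem Sx.
apply: (@cvg_comp _ _ _ (f : subspace S -> R) (@ln R) _ (nbhs (f x))).
  exact: cf.
exact/continuous_ln/f0.
Qed.

Lemma within_continuous_integrable (m : {measure set (E R n) -> \bar R}) (f : V -> R) :
  (m S < +oo)%E -> {within S, continuous f} ->
  m.-integrable (S : set (E R n)) (EFin \o (f : E R n -> R)).
Proof.
move=> mS cf; have [M _ fM] := sphere_bounded cf.
apply: measurable_bounded_integrable => //.
- exact: measurable_sphere.
- exact: within_continuous_measurable.
exists M; split; first exact: num_real.
by move=> a Ma x Sx; rewrite /= (le_trans (fM x Sx))// ltW.
Qed.

Lemma within_ln_integrable (m : {measure set (E R n) -> \bar R}) (g : V -> R) :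
  (m S < +oo)%E -> {within S, continuous g} -> (forall x, S x -> 0 < g x) ->
  m.-integrable (S : set (E R n)) (fun N : E R n => (ln (g N))%:E).
Proof.
move=> mS gc g0.
exact: (within_continuous_integrable mS (within_ln_continuous gc g0)).
Qed.

Lemma supp_gt0 (r : V -> R) N : {within S, continuous r} ->
  (forall x, S x -> 0 < r x) -> S N -> 0 < supp r S N.
Proof.
move=> cr r0 SN; have [M _ rM] := sphere_bounded cr.
apply: lt_le_trans (le_supp (@subset_refl _ S) rM N SN).
by rewrite SN mulr1 r0.
Qed.

(** The constraint is the logarithm of [r x * <x, N> <= supp r S N]. Every perturbation of a radial
    function thus comes with a competitor for [Q]. *)
Lemma admissible_supp (r : V -> R) : {within S, continuous r} ->
  (forall x, S x -> 0 < r x) -> admissible (supp r S) r.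
Proof.
move=> cr r0; have [M _ rM] := sphere_bounded cr.
split => //.
- by apply: continuous_subspaceT; exact: (continuous_supp (@subset_refl _ S) rM sphere_nonempty).
- by move=> N SN; exact: supp_gt0.
move=> x N Sx SN xN; rewrite lerBrDr -lnM ?posrE ?r0//.
rewrite ler_ln ?posrE ?mulr_gt0 ?r0 ?supp_gt0//.
by rewrite mulrC (le_supp (@subset_refl _ S) rM).
Qed.

Variables (sig mu : {measure set (E R n) -> \bar R}).
Hypotheses (sigE : standard_sphere_measure sig) (muS : mu S = sig S).

Variable rho : V -> R.
Hypothesis rhoc : {within S, continuous rho}.
Hypothesis rho0 : forall x, S x -> 0 < rho x.

Let B := multi_contact rho.
Let X := contact_inv rho.
Let H := supp rho S.

Let sigS : (sig S < +oo)%E. Proof. exact: sphere_measure_fin. Qed.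
Let mu_fin : (mu S < +oo)%E. Proof. by rewrite muS. Qed.

Lemma atpre_contact (g : V -> \bar R) N : (S `\` B) N ->
  atpre (contact rho) g N = g (X N).
Proof.
move=> DN; rewrite /atpre; case: pselect => // -[].
exists (X N); split; first by apply: contact_invP => //; case: DN.
by move=> x cx; rewrite (contact_inv_unique rhoc DN cx).
Qed.

Section Perturbation.
Variables (f : V -> R) (M : R).
Hypotheses (fc : {within S, continuous f}) (M0 : 0 < M).
Hypothesis fM : forall x, S x -> `|f x| <= M.

(** The exponential keeps the function positive for every [s] and makes its logarithm affine in
    [s]. *)
Definition perturb (s : R) (x : V) : R := rho x * expR (s * f x).

Let Hs s := supp (perturb s) S.

Lemma perturb_gt0 s x : S x -> 0 < perturb s x.
Proof. by move=> Sx; rewrite mulr_gt0 ?rho0 ?expR_gt0. Qed.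

Lemma perturb_continuous s : {within S, continuous (perturb s)}.
Proof.
move=> x; apply: cvgM; first exact: rhoc.
apply: (@cvg_comp _ _ _ (fun x : subspace S => s * f x) (@expR R) _ (nbhs (s * f x))).
  by apply: cvgM; [exact: cvg_cst|exact: fc].
exact: continuous_expR.
Qed.

Let le_H x N : S x -> rho x * dot x N <= H N.
Proof. by move=> Sx; have [K _ rK] := sphere_bounded rhoc; exact: (le_supp (@subset_refl _ S) rK). Qed.

Let le_Hs s x N : S x -> perturb s x * dot x N <= Hs s N.
Proof.
by move=> Sx; have [K _ rK] := sphere_bounded (@perturb_continuous s); exact: (le_supp (@subset_refl _ S) rK).
Qed.

Let H_gt0 N : S N -> 0 < H N. Proof. exact: supp_gt0. Qed.

Let Hs_gt0 s N : S N -> 0 < Hs s N.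
Proof.
by move=> SN; apply: supp_gt0 => //; [exact: perturb_continuous|exact: perturb_gt0].
Qed.

Lemma perturb_term_le s t x N b : S x -> 0 <= b ->
  rho x * dot x N <= b -> s * f x <= t -> perturb s x * dot x N <= expR t * b.
Proof.
move=> Sx b0 xNb st; rewrite /perturb mulrAC mulrC.
(* The exponential factor can be enlarged only in front of a positive term; a nonpositive term lies
   below the nonnegative right-hand side anyway. *)
have [xN|xN] := leP (rho x * dot x N) 0.
  rewrite (@le_trans _ _ 0)//; last by rewrite mulr_ge0// expR_ge0.
  by rewrite pmulr_rle0// expR_gt0.
by apply: ler_pM => //; [exact: ltW|rewrite ler_expR].
Qed.

Lemma supp_perturb_le s t N : S N -> (forall x, S x -> s * f x <= t) ->
  Hs s N <= expR t * H N.
Proof.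
move=> SN st; apply: supp_le; first exact: sphere_nonempty.
by move=> x Sx; apply: perturb_term_le => //; [exact/ltW/H_gt0|exact: le_H|exact: st].
Qed.

(** The unperturbed contact point [X N] is tested in the perturbed supremum. *)
Lemma supp_perturb_ge s N : S N -> expR (s * f (X N)) * H N <= Hs s N.
Proof.
move=> SN; have [SX _ XN] := contact_invP rhoc SN.
by rewrite /H -XN mulrA [expR _ * _]mulrC; exact: le_Hs.
Qed.

(** The points where [f] exceeds [f (X N)] by at least [e] form a compact set [C] avoiding the
    unique contact point. On [C] the unperturbed terms stay below some [c < H N], a deficit that a
    small [s] cannot make up. *)
Lemma supp_perturb_eventually_le N e : (S `\` B) N -> 0 < e ->
  exists2 d, 0 < d & forall s, 0 < s -> s <= d ->
    Hs s N <= expR (s * (f (X N) + e)) * H N.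
Proof.
move=> DN e0; have SN : S N by case: DN.
have [SX _ _] := contact_invP rhoc SN.
pose C := S `&` f @^-1` [set t | f (X N) + e <= t].
have cC : closed C by apply: closed_within => //; exact: closed_ge.
have [c /andP[c0 cH] cC' ] : exists2 c, 0 < c < H N &
    forall x, C x -> rho x * dot x N <= c.
  have HN := H_gt0 SN.
  have [C0|/set0P C0] := eqVneq C set0.
    by exists (H N / 2); [lra|move=> x; rewrite C0].
  have CS : C `<=` S by move=> x [].
  have [K _ rK] := sphere_bounded rhoc.
  have [y Cy yC] := supp_attained N rhoc cC CS C0.
  (* The maximum with [H N / 2] makes [c] positive, so that [ln c] is meaningful. *)
  exists (Num.max (supp rho C N) (H N / 2)).
    rewrite lt_max gt_max; apply/andP; split; first by apply/orP; right; lra.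
    apply/andP; split; last lra.
    rewrite lt_neqAle -yC le_H ?andbT; last exact: CS.
    apply/eqP => yH; have cy : contact rho y N by split => //; exact: CS.
    by case: Cy => _ /=; rewrite (contact_inv_unique rhoc DN cy) -/X; lra.
  move=> x Cx; rewrite le_max; apply/orP; left.
  by apply: le_supp => // z Cz; apply: rK; exact: CS.
have k0 : 0 < ln (H N) - ln c.
  by rewrite subr_gt0 ltr_ln ?posrE// H_gt0.
(* For such [s], [expR (s * M) * c <= expR (- (s * M)) * H N], and [- M <= f (X N)]. *)
exists ((ln (H N) - ln c) / (2 * M)); first by rewrite divr_gt0// mulr_gt0.
move=> s s0; rewrite ler_pdivlMr ?mulr_gt0// => sM.
apply: supp_le; first exact: sphere_nonempty.
move=> x Sx; have [fx|fx] := leP (f x) (f (X N) + e).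
  by apply: perturb_term_le => //; [exact/ltW/H_gt0|exact: le_H|rewrite ler_wpM2l// ltW].
have Cx : C x by split => //=; exact: ltW.
have h1 : perturb s x * dot x N <= expR (s * M) * c.
  apply: perturb_term_le => //; [exact: ltW|exact: cC'|].
  by apply: ler_wpM2l; [exact: ltW|exact: le_trans (ler_norm _) (fM Sx)].
apply: (le_trans h1); rewrite -[c]lnK ?posrE// -[H N]lnK ?posrE ?H_gt0//.
rewrite -!expRD ler_expR.
have := fM SX; rewrite ler_norml => /andP[fX _].
have : s * - M <= s * f (X N) by rewrite ler_wpM2l// ltW.
have := mulr_gt0 s0 e0.
by lra.
Qed.

Definition diff_quot (s : R) (N : V) : R := (ln (Hs s N) - ln (H N)) / s.

Lemma diff_quot_ge s N : S N -> 0 < s -> f (X N) <= diff_quot s N.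
Proof.
move=> SN s0; rewrite ler_pdivlMr// lerBrDr -ler_expR expRD !lnK ?posrE ?H_gt0 ?Hs_gt0//.
by have := supp_perturb_ge s SN; rewrite [s * _]mulrC.
Qed.

Lemma diff_quot_le s N t : S N -> 0 < s -> Hs s N <= expR (s * t) * H N ->
  diff_quot s N <= t.
Proof.
move=> SN s0 h; rewrite ler_pdivrMr// lerBlDr -ler_expR expRD.
by rewrite !lnK ?posrE ?H_gt0 ?Hs_gt0// [t * s]mulrC.
Qed.

Lemma diff_quot_bounded s N : S N -> 0 < s -> `|diff_quot s N| <= M.
Proof.
move=> SN s0; rewrite ler_norml; apply/andP; split.
  apply: le_trans (diff_quot_ge SN s0).
  have [SX _ _] := contact_invP rhoc SN.
  by have := fM SX; rewrite ler_norml => /andP[].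
apply: diff_quot_le => //; apply: supp_perturb_le => // x Sx.
by apply: ler_wpM2l; [exact: ltW|exact: le_trans (ler_norm _) (fM Sx)].
Qed.

Lemma diff_quot_continuous s : {within S, continuous (diff_quot s)}.
Proof.
move=> N; apply: cvgM; last exact: cvg_cst.
have [cH _ H0 _ _] := admissible_supp rhoc rho0.
have [cHs _ Hs0 _ _] := admissible_supp (@perturb_continuous s) (@perturb_gt0 s).
by apply: cvgB; [exact: (within_ln_continuous cHs)|exact: (within_ln_continuous cH)].
Qed.

End Perturbation.

Hypothesis minQ : forall h r, admissible h r ->
  (Qfun sig mu (supp rho S) rho <= Qfun sig mu h r)%E.

Let mB : measurable (B : set (E R n)).
Proof. by have [] := multi_contact_null sigE rhoc rho0. Qed.

Let B0 : sig B = 0%E.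
Proof. by have [] := multi_contact_null sigE rhoc rho0. Qed.

Let mD : measurable (S `\` B : set (E R n)).
Proof. by apply: measurableD => //; exact: measurable_sphere. Qed.

Let sigD : (sig (S `\` B) < +oo)%E.
Proof.
apply: le_lt_trans sigS; apply: le_measure; rewrite ?inE//.
exact: measurable_sphere.
Qed.

Lemma measurable_comp_contact_inv (f : V -> R) : {within S, continuous f} ->
  measurable_fun (S `\` B : set (E R n)) (fun N : E R n => f (X N)).
Proof.
move=> fc; apply: (@measurable_comp _ _ _ _ _ _ (S : set (E R n)) (f : E R n -> R)).
- exact: measurable_sphere.
- by move=> _ [N [SN _] <-]; have [] := contact_invP rhoc SN.
- exact: within_continuous_measurable.
- exact: (measurable_contact_inv sigE rhoc rho0).
Qed.

Lemma comp_contact_inv_integrable (f : V -> R) : {within S, continuous f} ->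
  sig.-integrable (S `\` B : set (E R n)) (fun N : E R n => (f (X N))%:E).
Proof.
move=> fc; have [M _ fM] := sphere_bounded fc.
apply: (@measurable_bounded_integrable _ _ _ _ (fun N : E R n => f (X N))) => //.
  exact: measurable_comp_contact_inv.
exists M; split; first exact: num_real.
move=> a Ma N [SN _]; rewrite /= (le_trans (fM _ _))// ?ltW//.
by have [] := contact_invP rhoc SN.
Qed.

(** Minimality of [Q] against the perturbed pair, divided by [s]: the radial term changes by exactly
    [s] times the integral of [f]. Finiteness of all integrals justifies the rearrangement. *)
Lemma diff_quot_integral_ge (f : V -> R) (s : R) : {within S, continuous f} ->
  0 < s ->
  (\int[mu]_(x in S) (f x)%:E <= \int[sig]_(N in S) (diff_quot f s N)%:E)%E.
Proof.
move=> fc s0.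
have adm := admissible_supp rhoc rho0.
have adms := admissible_supp (perturb_continuous fc (s := s)) (perturb_gt0 f s).
have iln := within_ln_integrable.
have [cH _ H0 _ _] := adm; have [cHs crs Hs0 rs0 _] := adms.
have if_ := within_continuous_integrable mu_fin fc.
have isf : mu.-integrable S (fun N : E R n => (s%:E * (f N)%:E)%E).
  by apply: integrableZl => //; exact: measurable_sphere.
have := minQ adms; rewrite /Qfun.
have -> : (\int[mu]_(x in S) (ln (perturb f s x))%:E =
    \int[mu]_(x in S) (ln (rho x))%:E + s%:E * \int[mu]_(x in S) (f x)%:E)%E.
  rewrite -integralZl//; last exact: measurable_sphere.
  rewrite -integralD//; [|exact: measurable_sphere|exact: iln].
  apply: eq_integral => x /set_mem Sx.
  by rewrite /perturb lnM ?posrE ?expR_gt0 ?rho0// expRK.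
have -> : (\int[sig]_(N in S) (diff_quot f s N)%:E =
   s^-1%:E * (\int[sig]_(N in S) (ln (supp (perturb f s) S N))%:E -
           \int[sig]_(N in S) (ln (supp rho S N))%:E))%E.
  rewrite -integralB//; [|exact: measurable_sphere|exact: iln|exact: iln].
  rewrite -integralZl//; last first.
    by apply: integrableB; [exact: measurable_sphere|exact: iln|exact: iln].
    exact: measurable_sphere.
  by apply: eq_integral => N _; rewrite /diff_quot -EFinB -EFinM mulrC.
have fin (m : {measure set (E R n) -> \bar R}) g (ig : m.-integrable (S : set (E R n)) g) :
    (\int[m]_(x in S) g x)%E \is a fin_num.
  exact: (integrable_fin_num measurable_sphere ig).
have aux (a b c d : \bar R) : a \is a fin_num -> b \is a fin_num ->
    c \is a fin_num -> d \is a fin_num ->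
    (a - b <= c - (b + s%:E * d) -> d <= s^-1%:E * (c - a))%E.
  case: a => // a; case: b => // b; case: c => // c; case: d => // d _ _ _ _.
  rewrite -EFinM -EFinD -!EFinB -EFinM !lee_fin => h.
  by rewrite mulrC ler_pdivlMr//; lra.
apply: aux; apply: fin => //; exact: iln.
Qed.

(** Dominated convergence along [s = 1 / (k + 1)], with the constant bound [M] on a set of finite
    measure. *)
Lemma integral_le_contact (f : V -> R) : {within S, continuous f} ->
  (\int[mu]_(x in S) (f x)%:E <= \int[sig]_(N in S `\` B) (f (X N))%:E)%E.
Proof.
move=> fc; have [M M0 fM] := sphere_bounded fc.
pose u k (N : E R n) := (diff_quot f k.+1%:R^-1 N)%:E : \bar R.
have s0 k : 0 < k.+1%:R^-1 :> R by rewrite invr_gt0.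
have mu_ k : measurable_fun (S `\` B : set (E R n)) (u k).
  apply/measurable_EFinP; apply: (@measurable_funS _ _ _ _ (S : set (E R n))).
  - exact: measurable_sphere.
  - by move=> N [].
  - apply: within_continuous_measurable; exact: (diff_quot_continuous fc).
have mf : measurable_fun (S `\` B : set (E R n)) (fun N : E R n => (f (X N))%:E).
  by apply/measurable_EFinP; exact: measurable_comp_contact_inv.
have [] := @dominated_convergence _ _ _ sig _ mD u (fun N => (f (X N))%:E)
  (cst M%:E) mu_ mf.
- apply: aeW => N DN; apply: cvg_EFin; first exact: nearW.
  apply/cvgrPdist_le => e e0.
  have SN : S N by case: DN.
  have [d d0 dP] := supp_perturb_eventually_le fc M0 fM DN e0.
  near=> k; have kd : k.+1%:R^-1 <= d by near: k; apply: filterS (near_infty_natSinv_lt (PosNum d0)) => k /ltW.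
  rewrite /= ler_norml; have := diff_quot_ge fc SN (s0 k).
  have := @diff_quot_le f fc (k.+1%:R^-1) N (f (X N) + e) SN (s0 k).
  by move=> /(_ (dP _ (s0 k) kd)); lra.
- apply: (@measurable_bounded_integrable _ _ _ _ (cst M)) => //.
  by exists M; split; [exact: num_real|move=> a Ma N _; rewrite /= gtr0_norm// ltW].
- apply: aeW => N k [SN _]; rewrite /u abse_EFin lee_fin.
  exact: diff_quot_bounded.
move=> _ _ ucvg; apply: cvge_ge ucvg; apply: nearW => k.
rewrite /= /u -(@integral_setD_null _ _ _ sig S B)//.
exact: diff_quot_integral_ge.
Unshelve. all: by end_near. Qed.

Lemma integral_contact (f : V -> R) : {within S, continuous f} ->
  (\int[sig]_(N in S `\` B) (f (X N))%:E = \int[mu]_(x in S) (f x)%:E)%E.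
Proof.
move=> fc; apply/eqP; rewrite eq_le integral_le_contact// andbT.
have Nfc : {within S, continuous (fun x => - f x)}.
  by move=> x; apply: cvgN; exact: fc.
have := integral_le_contact Nfc.
have -> : (\int[mu]_(x in S) (- f x)%:E = - \int[mu]_(x in S) (f x)%:E)%E.
  rewrite -integralN//=.
  exact: (integrable_add_def measurable_sphere (within_continuous_integrable mu_fin fc)).
have -> : (\int[sig]_(N in S `\` B) (- f (X N))%:E =
    - \int[sig]_(N in S `\` B) (f (X N))%:E)%E.
  rewrite -integralN//=.
  exact: (integrable_add_def mD (comp_contact_inv_integrable fc)).
by rewrite leeN2.
Qed.

Lemma contact_in_Theta : (forall x, S x -> exists N, contact rho x N) ->
  in_Theta sig mu (contact rho).
Proof.
move=> ex; split; first by move=> x N [].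
split; first exact: ex.
split.
  by move=> N SN; exists (X N); exact: contact_invP.
split; first by move=> w mw _; exact: leb_measurable_contact_image.
split; first by apply/negligibleP.
move=> f fc; rewrite -(integral_contact fc) (@integral_setD_null _ _ _ sig S B)//.
by apply: eq_integral => N /set_mem DN; rewrite atpre_contact.
Qed.

End Variation.

(** * Duality *)

Section Duality.
Context {R : realType} {n : nat}.
Local Notation V := 'rV[R]_(n.+1).
Local Notation S := (@sphere R n).
Variables (sig mu : {measure set (E R n) -> \bar R}).
Hypothesis sigE : standard_sphere_measure sig.

Let sigS : (sig S < +oo)%E. Proof. exact: sphere_measure_fin. Qed.

Lemma measurable_fun_dot (D : set (E R n)) (f : E R n -> V) :
  (forall i, measurable_fun D (fun N => f N 0 i)) ->
  measurable_fun D (fun N : E R n => dot (f N) N).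
Proof.
move=> mf; rewrite /dot.
have : forall s : seq 'I_n.+1,
    measurable_fun D (fun N : E R n => \sum_(i <- s) f N 0 i * (N : V) 0 i).
  elim=> [|i s IH].
    by under eq_fun do rewrite big_nil; exact: measurable_cst.
  under eq_fun do rewrite big_cons.
  apply: measurable_funD => //; apply: measurable_funM => //.
  apply: (@measurable_funS _ _ _ _ setT) => //.
  apply: (within_continuous_measurable (D := setT)).
  by apply: continuous_subspaceT; exact: coord_continuous.
by apply.
Qed.

Lemma measurable_ln_extended :
  measurable_fun setT (fun t : R => if 0 < t then (ln t)%:E else -oo%E).
Proof.
apply: measurable_fun_ifT.
- by apply: measurable_fun_ltr; [exact: measurable_cst|exact: measurable_id].
- by apply/measurable_EFinP; exact: measurable_ln.
- exact: measurable_cst.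
Qed.

Section Theta.
Variable th : V -> V -> Prop.
Hypothesis thT : in_Theta sig mu th.

Definition inv_at (N : V) : V := xget 0 (mpre th N).

Lemma atpre_inv_at (g : V -> \bar R) N : (exists! x, th x N) ->
  atpre th g N = g (inv_at N).
Proof. by rewrite /atpre; case: pselect. Qed.

Lemma inv_atP N : (exists! x, th x N) -> th (inv_at N) N.
Proof. by move=> [x [xN _]]; apply: (@xgetPex _ 0 (mpre th N)); exists x. Qed.

Let threshold (k : nat) : R := ratr (odflt 0 (unpickle k)).

Let threshold_between (a b : R) : a < b -> exists k, a < threshold k < b.
Proof.
move=> /rat_in_itvoo[q]; rewrite in_itv /= => qab.
by exists (pickle q); rewrite /threshold pickleK.
Qed.

(** For each rational level, the image under [th] of the superlevel set of [f] lies between two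
    Borel sets differing by a null set. [Z] collects these differences and the normals with several
    preimages; off [Z], [f (inv_at N) > r] means that [N] is in an inner set of some level above
    [r]. *)
Lemma measurable_inv_at (f : V -> R) : {within S, continuous f} ->
  exists Z : set (E R n), [/\ measurable Z, sig Z = 0%E,
    forall N, S N -> ~ Z N -> exists! x, th x N &
    measurable_fun ((S : set (E R n)) `\` Z) (fun N : E R n => f (inv_at N))].
Proof.
move=> fc; have [thS [_ [surj [thm [[Z0 [mZ0 Z00 badZ0]] _]]]]] := thT.
have mf := within_continuous_measurable fc.
have /choice[BB BBP] : forall k, exists BB : set (E R n) * set (E R n),
    [/\ measurable BB.1, measurable BB.2,
    BB.1 `<=` mimg th (S `&` f @^-1` `]threshold k, +oo[),
    mimg th (S `&` f @^-1` `]threshold k, +oo[) `<=` BB.2 &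
    sig (BB.2 `\` BB.1) = 0%E].
  move=> k; have mw : measurable (S `&` f @^-1` `]threshold k, +oo[ : set (E R n)).
    by apply: mf; [exact: measurable_sphere|exact: measurable_itv].
  have [|B1 [B2 H]] := thm _ mw; first by move=> x [].
  by exists (B1, B2).
pose Z := Z0 `|` \bigcup_k ((BB k).2 `\` (BB k).1).
have mZ' : measurable (\bigcup_k ((BB k).2 `\` (BB k).1)).
  by apply: bigcupT_measurable => k; have [m1 m2 _ _ _] := BBP k; exact: measurableD.
have mZ : measurable Z by exact: measurableU.
have uniq N : S N -> ~ Z N -> exists! x, th x N.
  move=> SN nZ; have [x xN] := surj _ SN; exists x; split => // y yN.
  apply: contrapT => xy; apply: nZ; left; apply: badZ0; split => //.
  by exists x, y.
have mD : measurable ((S : set (E R n)) `\` Z).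
  by apply: measurableD => //; exact: measurable_sphere.
exists Z; split => //.
  apply/negligibleP => //; apply: negligibleU; first exact/negligibleP.
  apply: negligible_bigcup => k; have [m1 m2 _ _ z] := BBP k.
  by apply/negligibleP => //; exact: measurableD.
apply: (measurability _ (RGenOInfty.measurableE R)) => //.
move=> _ [_ [r ->] <-].
rewrite (_ : _ `&` _ = ((S : set (E R n)) `\` Z) `&`
    \bigcup_(k in [set k | r < threshold k]) (BB k).1); last first.
  apply/seteqP; split=> N [[SN nZ]].
    rewrite /= in_itv /= andbT => /threshold_between[k /andP[rk kf]].
    have tN := inv_atP (uniq _ SN nZ).
    split => //; exists k => //; apply: contrapT => nB.
    apply: nZ; right; exists k => //; split => //.
    have [_ _ _ sub _] := BBP k; apply: sub.
    exists (inv_at N); split => //; split; first by have [] := thS _ _ tN.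
    by rewrite /= in_itv /= kf.
  move=> [k /= rk Bk]; split => //; rewrite /= in_itv /= andbT.
  have [_ _ sub _ _] := BBP k.
  have [x [[Sx /=]]] := sub _ Bk; rewrite in_itv /= andbT => kx xN.
  have [y [yN yu]] := uniq _ SN nZ.
  rewrite -(yu _ (inv_atP (uniq _ SN nZ))) (yu _ xN).
  exact: lt_trans kx.
apply: measurableI => //; apply: bigcup_measurable => k _.
by have [] := BBP k.
Qed.

Variable rho : V -> R.
Hypothesis rhoc : {within S, continuous rho}.
Hypothesis rho0 : forall x, S x -> 0 < rho x.

(* Stated with a null set because [inv_at] is measurable only for the completed
   sigma-algebra. *)
Lemma Theta_regular : exists Z : set (E R n), [/\ measurable Z, sig Z = 0%E,
    forall N, S N -> ~ Z N -> exists! x, th x N,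
    measurable_fun ((S : set (E R n)) `\` Z) (fun N : E R n => ln (rho (inv_at N))) &
    measurable_fun ((S : set (E R n)) `\` Z) (fun N : E R n => cost (inv_at N) N)].
Proof.
have [Z [mZ Z0 uZ mln]] := measurable_inv_at (within_ln_continuous rhoc rho0).
have cc i : {within S, continuous (fun x : V => x 0 i)}.
  by apply: continuous_subspaceT; exact: coord_continuous.
have /choice[W WP] := fun i => measurable_inv_at (cc i).
(* The null sets of the coordinates are united over [nat], with the empty set at indices beyond
   [n]. *)
pose Z' := Z `|` \bigcup_k (if insub k is Some i then W i else set0).
have mW k : measurable (if @insub nat (fun i => i < n.+1)%N 'I_n.+1 k is Some i then W i else set0).
  by case: insub => // i; have [] := WP i.
have mZ' : measurable Z' by apply: measurableU => //; exact: bigcupT_measurable.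
have ZZ' : Z `<=` Z' by move=> N ZN; left.
have WZ' i : W i `<=` Z' by move=> N WN; right; exists i => //; rewrite valK.
have mD (A : set (E R n)) : measurable A -> measurable ((S : set (E R n)) `\` A).
  by move=> mA; apply: measurableD => //; exact: measurable_sphere.
have subD (A : set (E R n)) : A `<=` Z' ->
    (S : set (E R n)) `\` Z' `<=` (S : set (E R n)) `\` A.
  by move=> AZ N [SN nZ]; split => // AN; apply: nZ; exact: AZ.
exists Z'; split => //.
- apply/negligibleP => //; apply: negligibleU; first exact/negligibleP.
  apply: negligible_bigcup => k; apply/negligibleP => //.
  by case: insub => // [i]; have [] := WP i.
- by move=> N SN nZ; apply: uZ => // ZN; apply: nZ; left.
- by apply: measurable_funS mln; [exact: mD|exact: subD].
- apply: (measurableT_comp measurable_ln_extended).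
  apply: (@measurable_fun_dot _ (fun N => inv_at N)) => i; have [mWi _ _ mi] := WP i.
  by apply: measurable_funS mi; [exact: mD|exact: subD].
Qed.

Let H := supp rho S.

Let cost_le0 x N : S x -> S N -> (cost x N <= 0)%E.
Proof.
move=> Sx SN; rewrite /cost; case: ifP => // xN; rewrite ?leNye// lee_fin.
by rewrite ln_le0// dot_sphere_le1.
Qed.

Let cost_le x N : S x -> S N -> (cost x N <= (ln (H N) - ln (rho x))%:E)%E.
Proof.
move=> Sx SN; rewrite /cost; case: ifP => xN; rewrite ?leNye// lee_fin.
by have [_ _ _ _] := admissible_supp rhoc rho0; apply.
Qed.

(** Equality in the admissibility constraint, exponentiated, is the contact equation. *)
Let cost_eq_contact x N : S x -> S N ->
  cost x N = (ln (H N) - ln (rho x))%:E -> contact rho x N.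
Proof.
move=> Sx SN; rewrite /cost; case: ifP => // xN [e].
have HN : 0 < H N by exact: supp_gt0.
apply: contactP => //; rewrite -/(H N) -ler_ln ?posrE ?mulr_gt0 ?rho0//.
by rewrite lnM ?posrE ?rho0// e; lra.
Qed.

Let contact_cost x N : contact rho x N ->
  cost x N = (ln (H N) - ln (rho x))%:E.
Proof.
move=> [Sx SN xN]; have HN : 0 < H N by exact: supp_gt0.
have d0 : 0 < dot x N by move: HN; rewrite /H -xN pmulr_rgt0// rho0.
rewrite /cost d0; congr EFin.
by rewrite /H -xN lnM ?posrE ?rho0//; lra.
Qed.

(** The transport condition of [th], applied to [ln rho], moves the [mu] integral of [Q] to [sig].
    Both functionals become integrals over [D], ready for pointwise comparison. *)
Lemma duality_on (Z : set (E R n)) (D := (S : set (E R n)) `\` Z) :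
  measurable Z -> sig Z = 0%E ->
  (forall N, S N -> ~ Z N -> exists! x, th x N) ->
  measurable_fun D (fun N : E R n => ln (rho (inv_at N))) ->
  [/\ Jcost sig th = (\int[sig]_(N in D) cost (inv_at N) N)%E,
    Qfun sig mu H rho =
      (\int[sig]_(N in D) (ln (H N) - ln (rho (inv_at N)))%:E)%E &
    sig.-integrable D (fun N : E R n => (ln (H N) - ln (rho (inv_at N)))%:E)].
Proof.
move=> mZ Z0 uZ mln; have [thS [_ [_ [_ [_ thf]]]]] := thT.
have mD : measurable D by apply: measurableD => //; exact: measurable_sphere.
have sigD : (sig D < +oo)%E.
  apply: le_lt_trans sigS; apply: le_measure; rewrite ?inE//.
    exact: measurable_sphere.
  by move=> N [].
have [cH _ H0 _ _] := admissible_supp rhoc rho0.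
have lrc := within_ln_continuous rhoc rho0.
have iH : sig.-integrable D (fun N : E R n => (ln (H N))%:E).
  apply: (integrableS measurable_sphere mD); first by move=> N [].
  exact: within_ln_integrable.
have ir : sig.-integrable D (fun N : E R n => (ln (rho (inv_at N)))%:E).
  have [M _ rM] := sphere_bounded lrc.
  apply: (@measurable_bounded_integrable _ _ _ _ (fun N : E R n => ln (rho (inv_at N)))) => //.
  exists M; split; first exact: num_real.
  move=> a Ma N [SN nZ]; rewrite /= (le_trans (rM _ _))// ?ltW//.
  by have [] := thS _ _ (inv_atP (uZ _ SN nZ)).
split.
- rewrite /Jcost (@integral_setD_null _ _ _ sig S Z)//.
  by apply: eq_integral => N /set_mem[SN nZ]; rewrite atpre_inv_at//; exact: uZ.
- rewrite /Qfun -(thf _ lrc) !(@integral_setD_null _ _ _ sig S Z)//.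
  have -> : (\int[sig]_(N in D) (ln (H N) - ln (rho (inv_at N)))%:E =
      \int[sig]_(N in D) (ln (H N))%:E -
      \int[sig]_(N in D) (ln (rho (inv_at N)))%:E)%E by rewrite -integralB.
  congr (_ - _)%E; apply: eq_integral => N /set_mem[SN nZ].
  by rewrite atpre_inv_at//; exact: uZ.
- exact: (integrableB mD iH ir).
Qed.

(** The pointwise bound [cost_le] is integrated by [le0_integral_le]; its equality case gives
    contact at [inv_at N] for almost every [N], where the preimage is also a singleton. *)
Lemma Jcost_le_Qfun : (Jcost sig th <= Qfun sig mu H rho)%E /\
  (Jcost sig th = Qfun sig mu H rho ->
   {ae sig, forall N : E R n, S N ->
     exists x, mpre th N = [set x] /\ contact rho x N}).
Proof.
have [thS _] := thT.
have [Z [mZ Z0 uZ mln mc]] := Theta_regular.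
have [-> -> ig] := duality_on mZ Z0 uZ mln.
have mD : measurable ((S : set (E R n)) `\` Z).
  by apply: measurableD => //; exact: measurable_sphere.
have DS N : ((S : set (E R n)) `\` Z) N -> S (inv_at N) /\ S N.
  by move=> [SN nZ]; have [] := thS _ _ (inv_atP (uZ _ SN nZ)).
have [|N DN|le_cg eq_cg] := le0_integral_le mD mc ig.
- by move=> N /DS[]; exact: cost_le0.
- by have [] := DS _ DN; exact: cost_le.
split => // /eq_cg[W [mW W0 Wsub]].
exists (Z `|` W); split; first exact: measurableU.
  apply/negligibleP; first exact: measurableU.
  by apply: negligibleU; apply/negligibleP.
move=> N /= /not_implyP[SN nN].
have [ZN|nZ] := pselect (Z N); first by left.
right; apply: Wsub => /= cN; apply: nN.
have [SX _] := DS N (conj SN nZ).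
exists (inv_at N); split; last by apply: cost_eq_contact => //; exact: cN.
apply/seteqP; split=> x; last by move=> ->; exact/inv_atP/uZ.
have [y [yN yu]] := uZ _ SN nZ.
by move=> xN /=; rewrite -(yu _ xN) -(yu _ (inv_atP (uZ _ SN nZ))).
Qed.

Lemma Jcost_eq_Qfun : (forall x N, th x N -> contact rho x N) ->
  Jcost sig th = Qfun sig mu H rho.
Proof.
move=> thc; have [Z [mZ Z0 uZ mln _]] := Theta_regular.
have [-> -> _] := duality_on mZ Z0 uZ mln.
apply: eq_integral => N /set_mem[SN nZ].
exact/contact_cost/thc/inv_atP/uZ.
Qed.

End Theta.
End Duality.

(** * Optimality and almost everywhere uniqueness of the Gauss map *)

Unset Implicit Arguments.

Theorem theorem8 (R : realType) (n : nat)
  (sig mu : {measure set (E R n) -> \bar R}) (F : set 'rV[R]_(n.+1)) :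
  (1 <= n)%N ->
  standard_sphere_measure sig ->
  (* mu is a (nonnegative, countably additive) measure on Borel subsets of S^n *)
  mu (~` (@sphere R n)) = 0%E ->
  mu ((@sphere R n)) = sig ((@sphere R n)) ->
  (forall w : set (E R n), measurable w -> w `<=` (@sphere R n) -> w !=set0 ->
     w <> (@sphere R n) -> sconvex w ->
     (sig (polar w) < mu ((@sphere R n) `\` w))%E) ->
  (* F~ in F^n whose (supportf, radialf) pair minimizes Q over A *)
  in_Fn F ->
  admissible (supportf F) (radialf F) ->
  (forall h rho, admissible h rho ->
     (Qfun sig mu (supportf F) (radialf F) <= Qfun sig mu h rho)%E) ->
  (exists th0, in_Theta sig mu th0 /\
     forall th, in_Theta sig mu th -> (Jcost sig th <= Jcost sig th0)%E) /\
  (forall th0, in_Theta sig mu th0 ->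
     (forall th, in_Theta sig mu th -> (Jcost sig th <= Jcost sig th0)%E) ->
     {ae sig, forall N : E R n, (@sphere R n) N -> mpre th0 N = mpre (gauss F) N} /\
     (forall V : set (E R n), measurable V -> V `<=` (@sphere R n) -> (0 < mu V)%E ->
        negligible sig ((mimg th0 V `\` mimg (gauss F) V) `|`
                         (mimg (gauss F) V `\` mimg th0 V)))) /\
  Qfun sig mu (supportf F) (radialf F) = Jcost sig (gauss F) /\
  Jcost sig (gauss F) = ereal_sup [set Jcost sig th | th in in_Theta sig mu].
Proof.
move=> _ sigE _ muS _ [K [cK convK K0 FE]] [_ rhoc _ rho0 _] minQ.
rewrite (gauss_contact cK convK K0 FE rhoc).
set rho := radialf F; rewrite -/rho in rhoc rho0 minQ *.
have thT : in_Theta sig mu (contact rho).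
  exact: (contact_in_Theta sigE muS rhoc rho0 minQ
    (exists_contact cK convK K0 FE rhoc)).
have JQ : Jcost sig (contact rho) = Qfun sig mu (supp rho (@sphere R n)) rho.
  by apply: (Jcost_eq_Qfun sigE thT rhoc rho0).
have Jle th : in_Theta sig mu th -> (Jcost sig th <= Jcost sig (contact rho))%E.
  by move=> thT'; rewrite JQ; have [] := Jcost_le_Qfun sigE thT' rhoc rho0.
(* The equality case applied to the Gauss map itself: almost all of its preimages are singletons. *)
have unique_contact := (Jcost_le_Qfun sigE thT rhoc rho0).2 JQ.
split; first by exists (contact rho).
split; last first.
  split; first by rewrite JQ.
  apply/eqP; rewrite eq_le; apply/andP; split.
    by apply: ereal_sup_ubound; exists (contact rho).
  by apply: ge_ereal_sup => _ [th thT' <-]; exact: Jle.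
move=> th0 th0T th0max.
have J0 : Jcost sig th0 = Qfun sig mu (supp rho (@sphere R n)) rho.
  by apply/eqP; rewrite eq_le -JQ Jle// th0max.
have ae_eq0 : {ae sig, forall N : E R n, (@sphere R n) N ->
    mpre th0 N = mpre (contact rho) N}.
  have unique_th0 := (Jcost_le_Qfun sigE th0T rhoc rho0).2 J0.
  apply: filterS2 unique_contact unique_th0 => N uc ut SN.
  (* Both preimages are singletons, and the point [y] of the preimage under [th0] is a contact
     point, hence equals [x]. *)
  have [x [cx _]] := uc SN; have [y [-> cy]] := ut SN.
  have : mpre (contact rho) N y by [].
  by rewrite cx => /= ->.
(* A normal in only one of the two images of [W] has different preimages under the two maps, so the
   symmetric difference lies in the exceptional set of [ae_eq0]. *)
split => // W mW WS _; apply: negligibleS ae_eq0 => N nN /= eqN.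
have [th0S _] := th0T.
case: nN => -[[x [Wx xN]]] []; exists x; split => //.
  have [_ SN] := th0S _ _ xN.
  by have : mpre th0 N x by []; rewrite eqN.
have [_ SN _] := xN.
by have : mpre (contact rho) N x by []; rewrite -eqN.
Qed.
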